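(* Let $G$ be a finite group, $\mathcal S$ a finite right $G$-set, and $\alpha\in Z^2(G,\mathcal U(\mathbb C\mathcal S))$ a 2-cocycle with $\alpha(h,1)=\alpha(1,h)=\sum_{s\in\mathcal S}e(s)$ for all $h\in G$. With the notation of the context: i) For each $s\in\mathcal S$, the algebra $D(\mathcal O_s)$ is semisimple, and the simple $D(\mathcal O_s)$-modules are precisely the modules $\mathrm{Ind}_{S(s)}^{D(s)}M=D(s)\otimes_{S(s)}M$, where $M$ ranges over the simple $\mathbb C^{\alpha_s}[G_s]$-modules. ii) $A_\alpha(G,\mathcal S)$ is semisimple, and the simple $A_\alpha(G,\mathcal S)$-modules are precisely the modules $\mathrm{Ind}_{S(s_j)}^{D(s_j)}M$, where $M$ ranges over the simple $\mathbb C^{\alpha_{s_j}}[G_{s_j}]$-modules and $j\in J$.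
   Context: $\mathbb C\mathcal S=\bigoplus_{s\in\mathcal S}\mathbb C e(s)$ is the algebra with $e(s)e(t)=\delta_{s,t}e(t)$; $G$ acts on it on the right by $e(s)^g=e(sg)$. $\mathcal U(\mathbb C\mathcal S)=\{\sum_s\lambda_se(s)\mid\lambda_s\in\mathbb C^*\}$ is its unit group, a multiplicative right $G$-module. A 2-cocycle $\alpha\in Z^2(G,\mathcal U(\mathbb C\mathcal S))$ satisfies $\alpha(hk,l)\,\alpha(h,k)^l=\alpha(h,kl)\,\alpha(k,l)$; write $\alpha(h,k)=\sum_s\alpha_s(h,k)e(s)$, so $\alpha_s(hk,l)\alpha_{sl^{-1}}(h,k)=\alpha_s(h,kl)\alpha_s(k,l)$. $A_\alpha(G,\mathcal S)=\mathbb C[G]\otimes\mathbb C\mathcal S$ is the associative algebra with basis $g\otimes e(s)$ and product $(g\otimes e(s))\cdot(h\otimes e(t))=\alpha_t(g,h)\,gh\otimes e(sh)e(t)$. For $s\in\mathcal S$: $G_s=\{h\in G\mid sh=s\}$, $\mathcal O_s$ is the $G$-orbit of $s$, $S(s)=\mathrm{span}\{a\otimes e(s)\mid a\in G_s\}$, $D(s)=\mathrm{span}\{a\otimes e(s)\mid a\in G\}$, $D(\mathcal O_s)=\mathrm{span}\{a\otimes e(t)\mid a\in G,\ t\in\mathcal O_s\}$. The restriction of $\alpha_s$ to $G_s\times G_s$ is a 2-cocycle with values in $\mathbb C^*$, and $\mathbb C^{\alpha_s}[G_s]$ is the twisted group algebra (basis $\bar a$, $a\in G_s$, product $\bar a\bar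 b=\alpha_s(a,b)\overline{ab}$). The subalgebra $S(s)$ is identified with $\mathbb C^{\alpha_s}[G_s]$ via $a\otimes e(s)\mapsto\bar a$. $D(s)$ is a left ideal of $A_\alpha(G,\mathcal S)$ and $D(\mathcal O_s)$ a two-sided ideal with identity $\sum_{t\in\mathcal O_s}1\otimes e(t)$, so $D(s)\otimes_{S(s)}M$ is a module by left multiplication. $\mathcal S=\bigcup_{j\in J}\mathcal O_j$ is the decomposition into disjoint orbits, and $s_j\in\mathcal O_j$ are fixed representatives. *)

(* Defs.v *)
From HB Require Import structures.
From mathcomp Require Import all_boot all_order all_fingroup all_algebra.
From mathcomp Require Import boolp.
From mathcomp Require Import freeg.

Set Implicit Arguments.
Unset Strict Implicit.
Unset Printing Implicit Defensive.

Import GRing.Theory.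
Local Open Scope ring_scope.
Local Open Scope quotient_scope.

(* Rings are [pzRingType]s: A_alpha(G, S) is the zero ring when S is empty.   *)

Section Modules.

Variable R : pzRingType.
Implicit Types M N : lmodType R.

(* Submodules are boolean predicates; as every Prop is reflected by a boolean *)
(* classically, this covers all submodules.                                   *)
Definition simple_submod M (N : {pred M}) : Prop :=
  [/\ submod_closed N,
      exists2 x, x \in N & x != 0
    & forall N' : {pred M}, submod_closed N' -> {subset N' <= N} ->
        N' =i pred1 0 \/ N' =i N].

Definition simple_module M : Prop := simple_submod (predT : {pred M}).

Definition module_iso M N : Prop := exists f : {linear M -> N}, bijective f.

(* The left regular module is a direct sum of simple left ideals. A finite    *)
(* family loses nothing, since 1 has only finitely many nonzero components.   *)
Definition semisimple_ring : Prop :=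
  exists (n : nat) (L : 'I_n -> {pred R^o}),
    (forall i, simple_submod (L i)) /\
    (forall x : R^o, exists! c : {ffun 'I_n -> R^o},
        (forall i, c i \in L i) /\ x = \sum_i c i).

End Modules.

Definition restr (R S : pzRingType) (f : {rmorphism R -> S}) (M : lmodType S)
  : Type := M.

Section RestrictionOfScalars.

Variables (R S : pzRingType) (f : {rmorphism R -> S}) (M : lmodType S).

HB.instance Definition _ := GRing.Zmodule.on (restr f M).

Definition restr_scale (a : R) (v : restr f M) : restr f M := f a *: (v : M).

Fact restr_scaleA a b v :
  restr_scale a (restr_scale b v) = restr_scale (a * b) v.
Proof. by rewrite /restr_scale scalerA rmorphM. Qed.

Fact restr_scale1 : left_id 1 restr_scale.
Proof. by move=> v; rewrite /restr_scale rmorph1 scale1r. Qed.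

Fact restr_scaleDr : right_distributive restr_scale +%R.
Proof. by move=> a u v; rewrite /restr_scale scalerDr. Qed.

Fact restr_scaleDl v : {morph restr_scale^~ v : a b / a + b}.
Proof. by move=> a b; rewrite /restr_scale rmorphD scalerDl. Qed.

HB.instance Definition _ := GRing.Zmodule_isLmodule.Build R (restr f M)
  restr_scaleA restr_scale1 restr_scaleDr restr_scaleDl.

End RestrictionOfScalars.

Record bimodule (R S : pzRingType) := Bimodule {
  bim_sort :> lmodType R;
  ract : bim_sort -> S -> bim_sort;
  ractA : forall x a b, ract (ract x a) b = ract x (a * b);
  ract1 : forall x, ract x 1 = x;
  ractDl : forall x y a, ract (x + y) a = ract x a + ract y a;
  ractDr : forall x a b, ract x (a + b) = ract x a + ract x b;
  ract_scale : forall r x a, r *: ract x a = ract (r *: x) a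
}.

(* B (x)_S M: the quotient of the free abelian group on B * M by the          *)
(* subgroup generated by the biadditivity and S-balance relators.             *)
Section Tensor.

Variables (R S : pzRingType) (B : bimodule R S) (M : lmodType S).

Local Notation free := {freeg (B * M)%type / int}.

Definition gen (x : B) (m : M) : free := << (x, m) >>.

Inductive tensor_relator : free -> Prop :=
| relator_addl x y m : tensor_relator (gen (x + y) m - gen x m - gen y m)
| relator_addr x m n : tensor_relator (gen x (m + n) - gen x m - gen x n)
| relator_bal x a m : tensor_relator (gen (ract x a) m - gen x (a *: m)).

Definition tensor_rel : {pred free} := fun z =>
  `[< forall N : {pred free}, zmod_closed N ->
        (forall r, tensor_relator r -> r \in N) -> z \in N >].

Fact tensor_rel_closed : zmod_closed tensor_rel.
Proof.
split=> [|x y /asboolP Hx /asboolP Hy]; apply/asboolP => N NN HN.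
  by case: NN.
by case: (NN) => _; apply; [apply: Hx | apply: Hy].
Qed.

HB.instance Definition _ := GRing.isZmodClosed.Build free tensor_rel
  tensor_rel_closed.

Fact tensor_rel_gen r : tensor_relator r -> r \in tensor_rel.
Proof. by move=> Hr; apply/asboolP => N _; apply. Qed.

Fact tensor_rel_min (N : {pred free}) : zmod_closed N ->
  (forall r, tensor_relator r -> r \in N) -> {subset tensor_rel <= N}.
Proof. by move=> NN HN z /asboolP; apply. Qed.

Definition tensor : Type := Quotient.quot tensor_rel.

HB.instance Definition _ := GRing.Zmodule.on tensor.


Definition tens_pi : free -> tensor := \pi_(Quotient.quot tensor_rel).

Fact tens_piB z w : tens_pi (z - w) = tens_pi z - tens_pi w.
Proof. exact: (pi_is_zmod_morphism (Quotient.quot tensor_rel)). Qed.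

HB.instance Definition _ := GRing.isZmodMorphism.Build free tensor tens_pi tens_piB.

Fact tens_piP z w : reflect (tens_pi z = tens_pi w) (z - w \in tensor_rel).
Proof.
rewrite -[z - w \in _]/(Quotient.equiv tensor_rel z w) Quotient.equivE.
by rewrite (Quotient.idealrBE tensor_rel); apply: eqP.
Qed.

Fact tens_piW (P : tensor -> Prop) : (forall z, P (tens_pi z)) -> forall t, P t.
Proof. by move=> HP; apply: (@quotW _ (Quotient.quot tensor_rel)). Qed.

Definition tens (x : B) (m : M) : tensor := tens_pi (gen x m).

Fact tensDl x y m : tens (x + y) m = tens x m + tens y m.
Proof.
apply: subr0_eq; rewrite opprD addrA -!raddfB -(raddf0 tens_pi).
by apply/tens_piP; rewrite subr0; apply/tensor_rel_gen/relator_addl.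
Qed.

Fact tensDr x m n : tens x (m + n) = tens x m + tens x n.
Proof.
apply: subr0_eq; rewrite opprD addrA -!raddfB -(raddf0 tens_pi).
by apply/tens_piP; rewrite subr0; apply/tensor_rel_gen/relator_addr.
Qed.

Fact tens_bal x a m : tens (ract x a) m = tens x (a *: m).
Proof. exact/tens_piP/tensor_rel_gen/relator_bal. Qed.

Fact free_ind (P : free -> Prop) :
  (forall x m, P (gen x m)) -> (forall z w, P z -> P w -> P (z - w)) ->
  forall z, P z.
Proof.
move=> Pgen PB z.
have P0 : P 0 by rewrite -(subrr (gen 0 0)); apply: PB.
have PN u : P u -> P (- u) by rewrite -sub0r => /(PB _ _ P0).
have PD u v : P u -> P v -> P (u + v) by move=> Pu /PN/(PB _ _ Pu); rewrite opprK.
have PM u n : P u -> P (u *+ n).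
  by move=> Pu; elim: n => [|n IHn]; rewrite ?mulr0n // mulrS; apply: PD.
rewrite -[z]freeg_sumE; elim/big_ind: _ => // -[x m] _.
rewrite -[coeff _ _]intz -freegU_mulz; case: (coeff _ _) => n.
  by rewrite -pmulrn; exact: PM (Pgen x m).
by rewrite NegzE mulrNz -pmulrn; apply/PN; exact: PM (Pgen x m).
Qed.

Definition free_scale (r : R) : free -> free :=
  fglift (fun xm : B * M => gen (r *: xm.1) xm.2).

Fact free_scaleB r z w : free_scale r (z - w) = free_scale r z - free_scale r w.
Proof. exact: lift_is_additive. Qed.

HB.instance Definition _ r := GRing.isZmodMorphism.Build free free
  (free_scale r) (free_scaleB r).

Fact free_scale_gen r x m : free_scale r (gen x m) = gen (r *: x) m.
Proof. by rewrite /free_scale liftU scale1r. Qed.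

Fact free_scale_rel r z : z \in tensor_rel -> free_scale r z \in tensor_rel.
Proof.
apply: (tensor_rel_min (N := [pred z | free_scale r z \in tensor_rel])).
  split=> [|u v]; rewrite !inE; first by rewrite raddf0 rpred0.
  by rewrite raddfB; apply: rpredB.
move=> u; rewrite inE; case=> [x y m|x m n|x a m]; rewrite !raddfB /= !free_scale_gen.
- by rewrite scalerDr; apply/tensor_rel_gen/relator_addl.
- exact/tensor_rel_gen/relator_addr.
- by rewrite ract_scale; apply/tensor_rel_gen/relator_bal.
Qed.

Definition tensor_scale (r : R) (t : tensor) : tensor :=
  tens_pi (free_scale r (generic_quotient.repr (t : Quotient.quot tensor_rel))).

Fact tensor_scale_pi r z : tensor_scale r (tens_pi z) = tens_pi (free_scale r z).
Proof.
apply/tens_piP; rewrite -raddfB free_scale_rel //; apply/tens_piP.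
exact: (@reprK _ (Quotient.quot tensor_rel) _).
Qed.

Fact tensor_scale_tens r x m : tensor_scale r (tens x m) = tens (r *: x) m.
Proof. by rewrite tensor_scale_pi free_scale_gen. Qed.

Fact tensor_scaleDr : right_distributive tensor_scale +%R.
Proof.
by move=> r; elim/tens_piW=> u; elim/tens_piW=> v;
  rewrite -raddfD !tensor_scale_pi !raddfD.
Qed.

Fact tensor_ind (P : tensor -> Prop) :
  (forall x m, P (tens x m)) -> (forall t u, P t -> P u -> P (t - u)) ->
  forall t, P t.
Proof.
move=> Pt PB; elim/tens_piW; apply: free_ind => [//|z w Pz Pw].
by rewrite raddfB; apply: PB.
Qed.

Fact tensor_scaleB r t u :
  tensor_scale r (t - u) = tensor_scale r t - tensor_scale r u.
Proof.
by elim/tens_piW: t => z; elim/tens_piW: u => w;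
  rewrite -raddfB !tensor_scale_pi !raddfB.
Qed.

Fact tensor_scaleA r s t : tensor_scale r (tensor_scale s t) = tensor_scale (r * s) t.
Proof.
elim/tensor_ind: t => [x m|t u IHt IHu]; last by rewrite !tensor_scaleB IHt IHu.
by rewrite !tensor_scale_tens scalerA.
Qed.

Fact tensor_scale1 : left_id 1 tensor_scale.
Proof.
elim/tensor_ind=> [x m|t u IHt IHu]; last by rewrite !tensor_scaleB IHt IHu.
by rewrite tensor_scale_tens scale1r.
Qed.

Fact tensor_scaleDl t : {morph tensor_scale^~ t : r s / r + s}.
Proof.
move=> r s; elim/tensor_ind: t => [x m|t u IHt IHu].
  by rewrite !tensor_scale_tens scalerDl tensDl.
by rewrite !tensor_scaleB IHt IHu opprD addrACA.
Qed.

HB.instance Definition _ := GRing.Zmodule_isLmodule.Build R tensor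
  tensor_scaleA tensor_scale1 tensor_scaleDr tensor_scaleDl.

Fact scale_tens r x m : r *: tens x m = tens (r *: x) m.
Proof. exact: tensor_scale_tens. Qed.

End Tensor.

(* Algebras with a finite basis indexed by I, given by structure constants:   *)
(* [bmul i j] is the product of the i-th and j-th basis vectors.              *)
Section BasisAlgebra.

Variables (F : fieldType) (I : finType).

Definition bvec (i : I) : {ffun I -> F^o} := [ffun j => (j == i)%:R].

Definition bilin_ext (c : I -> I -> {ffun I -> F^o}) (a b : {ffun I -> F^o}) :
  {ffun I -> F^o} := \sum_i \sum_j (a i * b j) *: c i j.

Record basis_alg := BasisAlg {
  bmul : I -> I -> {ffun I -> F^o};
  bone : {ffun I -> F^o};
  bmulA : forall i j k,
    bilin_ext bmul (bmul i j) (bvec k) = bilin_ext bmul (bvec i) (bmul j k);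
  bmul1 : forall i, bilin_ext bmul bone (bvec i) = bvec i;
  bmulr1 : forall i, bilin_ext bmul (bvec i) bone = bvec i
}.

Fact bvec_sum (a : {ffun I -> F^o}) : a = \sum_i a i *: bvec i.
Proof.
apply/ffunP=> j; rewrite sum_ffunE (bigD1 j) //= big1 => [|i /negPf ij].
  by rewrite !ffunE eqxx addr0 [LHS](esym (mulr1 _)).
by rewrite !ffunE eq_sym ij scaler0.
Qed.

Fact bvec_ind (P : {ffun I -> F^o} -> Prop) :
  P 0 -> (forall a b, P a -> P b -> P (a + b)) ->
  (forall k a, P a -> P (k *: a)) -> (forall i, P (bvec i)) -> forall a, P a.
Proof.
move=> P0 PD PZ Pv a; rewrite (bvec_sum a).
by elim/big_ind: _ => // i _; apply: PZ.
Qed.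

Section Ext.
Variable c : I -> I -> {ffun I -> F^o}.

Fact bilin_extDl a a' b :
  bilin_ext c (a + a') b = bilin_ext c a b + bilin_ext c a' b.
Proof.
rewrite -big_split; apply: eq_bigr => i _ /=; rewrite -big_split.
by apply: eq_bigr => j _; rewrite ffunE mulrDl scalerDl.
Qed.

Fact bilin_extDr a b b' :
  bilin_ext c a (b + b') = bilin_ext c a b + bilin_ext c a b'.
Proof.
rewrite -big_split; apply: eq_bigr => i _ /=; rewrite -big_split.
by apply: eq_bigr => j _; rewrite ffunE mulrDr scalerDl.
Qed.

Fact bilin_extZl k a b : bilin_ext c (k *: a) b = k *: bilin_ext c a b.
Proof.
rewrite scaler_sumr; apply: eq_bigr => i _; rewrite scaler_sumr.
by apply: eq_bigr => j _; rewrite ffunE scalerA mulrA.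
Qed.

Fact bilin_extZr k a b : bilin_ext c a (k *: b) = k *: bilin_ext c a b.
Proof.
rewrite scaler_sumr; apply: eq_bigr => i _; rewrite scaler_sumr.
by apply: eq_bigr => j _; rewrite ffunE scalerA mulrCA.
Qed.

Fact bilin_ext0l b : bilin_ext c 0 b = 0.
Proof. by rewrite -[X in bilin_ext _ X _](scale0r 0) bilin_extZl scale0r. Qed.

Fact bilin_ext0r a : bilin_ext c a 0 = 0.
Proof. by rewrite -[X in bilin_ext _ _ X](scale0r 0) bilin_extZr scale0r. Qed.

Fact bilin_ext_bvec i j : bilin_ext c (bvec i) (bvec j) = c i j.
Proof.
rewrite /bilin_ext (bigD1 i) //= (bigD1 j) //= !ffunE !eqxx mulr1 scale1r.
rewrite big1 ?addr0 => [|k /negPf kj]; last by rewrite !ffunE kj mulr0 scale0r.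
rewrite big1 ?addr0 // => k /negPf ki; rewrite big1 // => l _.
by rewrite !ffunE ki mul0r scale0r.
Qed.

End Ext.

Definition balg (B : basis_alg) : Type := {ffun I -> F^o}.

Section Ring.
Variable B : basis_alg.
Local Notation A := (balg B).

HB.instance Definition _ := Vector.on A.

Definition balg_mul (a b : A) : A := bilin_ext (bmul B) a b.

Fact balg_mulA : associative balg_mul.
Proof.
rewrite /balg_mul => a b c.
elim/bvec_ind: a => [|a a' Ea Ea'|k a Ea|i].
- by rewrite !bilin_ext0l.
- by rewrite !bilin_extDl Ea Ea'.
- by rewrite !bilin_extZl Ea.
elim/bvec_ind: b => [|b b' Eb Eb'|k b Eb|j].
- by rewrite bilin_ext0l !bilin_ext0r bilin_ext0l.
- by rewrite bilin_extDl !bilin_extDr bilin_extDl Eb Eb'.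
- by rewrite bilin_extZl !bilin_extZr bilin_extZl Eb.
elim/bvec_ind: c => [|c c' Ec Ec'|k c Ec|k].
- by rewrite !bilin_ext0r.
- by rewrite !bilin_extDr Ec Ec'.
- by rewrite !bilin_extZr Ec.
by rewrite !bilin_ext_bvec bmulA.
Qed.

Fact balg_mul1 : left_id (bone B : A) balg_mul.
Proof.
rewrite /balg_mul; elim/bvec_ind => [|a b Ea Eb|k a Ea|i].
- exact: bilin_ext0r.
- by rewrite bilin_extDr Ea Eb.
- by rewrite bilin_extZr Ea.
- exact: bmul1.
Qed.

Fact balg_mulr1 : right_id (bone B : A) balg_mul.
Proof.
rewrite /balg_mul; elim/bvec_ind => [|a b Ea Eb|k a Ea|i].
- exact: bilin_ext0l.
- by rewrite bilin_extDl Ea Eb.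
- by rewrite bilin_extZl Ea.
- exact: bmulr1.
Qed.

Fact balg_mulDl : left_distributive balg_mul +%R.
Proof. by move=> a a' b; apply: bilin_extDl. Qed.

Fact balg_mulDr : right_distributive balg_mul +%R.
Proof. by move=> a b b'; apply: bilin_extDr. Qed.

HB.instance Definition _ := GRing.Zmodule_isPzRing.Build A
  balg_mulA balg_mul1 balg_mulr1 balg_mulDl balg_mulDr.

Fact balg_scaleAl (k : F) (a b : A) : k *: (a * b) = (k *: a) * b.
Proof. by rewrite -[LHS]bilin_extZl. Qed.

Fact balg_scaleAr (k : F) (a b : A) : k *: (a * b) = a * (k *: b).
Proof. by rewrite -[LHS]bilin_extZr. Qed.

Definition basis (i : I) : A := bvec i.

Fact basis_mul i j : basis i * basis j = bmul B i j.
Proof. exact: bilin_ext_bvec. Qed.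

Definition span_basis (P : {pred I}) : {vspace A} :=
  <<[seq basis i | i <- enum P]>>%VS.

Fact mem_span_basis (P : {pred I}) (a : A) :
  reflect (forall i, i \notin P -> (a : {ffun I -> F^o}) i = 0)
          (a \in span_basis P).
Proof.
apply: (iffP idP) => [|aP].
  move=> /coord_span -> i iP; rewrite sum_ffunE big1 // => k _.
  have ks : (k < size (enum P))%N by rewrite -cardE.
  rewrite ffunE [X in _ *: X](_ : _ = bvec (nth i (enum P) k) i); last first.
    by rewrite (nth_map i).
  rewrite ffunE; case: eqP => [ik|_]; last exact: mulr0.
  by case/negP: iP; rewrite -mem_enum ik mem_nth.
rewrite (bvec_sum a) rpred_sum // => i _; have [iP|/aP->] := boolP (i \in P).
  by apply/rpredZ/memv_span/map_f; rewrite mem_enum.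
by rewrite scale0r rpred0.
Qed.

Fact span_basis_ind (P : {pred I}) (K : A -> Prop) :
  K 0 -> (forall a b, K a -> K b -> K (a + b)) ->
  (forall (k : F) a, K a -> K (k *: a)) -> (forall i, i \in P -> K (basis i)) ->
  {in span_basis P, forall a, K a}.
Proof.
move=> K0 KD KZ Kb a /mem_span_basis aP; rewrite (bvec_sum a).
elim/big_ind: _ => // i _; have [iP|/aP->] := boolP (i \in P).
  exact/KZ/Kb.
by rewrite scale0r.
Qed.

Fact basis_in_span (P : {pred I}) i : i \in P -> basis i \in span_basis P.
Proof. by move=> iP; apply/memv_span/map_f; rewrite mem_enum. Qed.

Fact span_basis_mul (P Q : {pred I}) (W : {vspace A}) :
  {in P & Q, forall i j, basis i * basis j \in W} ->
  forall x y, x \in span_basis P -> y \in span_basis Q -> x * y \in W.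
Proof.
move=> PQ x y xP yQ; elim/span_basis_ind: x / xP => [|a b Ha Hb|k a Ha|i iP].
- by rewrite mul0r mem0v.
- by rewrite mulrDl memvD.
- by rewrite -balg_scaleAl memvZ.
elim/span_basis_ind: y / yQ => [|a b Ha Hb|k a Ha|j jQ].
- by rewrite mulr0 mem0v.
- by rewrite mulrDr memvD.
- by rewrite -balg_scaleAr memvZ.
exact: PQ.
Qed.

Fact span_basis_unitl (P : {pred I}) (e : A) :
  {in P, forall i, e * basis i = basis i} ->
  {in span_basis P, forall x, e * x = x}.
Proof.
move=> eP; apply: span_basis_ind => [|a b Ha Hb|k a Ha|//].
- exact: mulr0.
- by rewrite mulrDr Ha Hb.
- by rewrite -balg_scaleAr Ha.
Qed.

Fact span_basis_unitr (P : {pred I}) (e : A) :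
  {in P, forall i, basis i * e = basis i} ->
  {in span_basis P, forall x, x * e = x}.
Proof.
move=> eP; apply: span_basis_ind => [|a b Ha Hb|k a Ha|//].
- exact: mul0r.
- by rewrite mulrDl Ha Hb.
- by rewrite -balg_scaleAl Ha.
Qed.

End Ring.
End BasisAlgebra.

Section UnitalSubspaces.

Variables (F : fieldType) (I : finType) (B : basis_alg F I).
Local Notation A := (balg B).

(* A multiplicatively closed subspace with its own identity element, which    *)
(* need not be the identity of the ambient algebra.                           *)
Record unital_subspace := UnitalSubspace {
  us_space : {vspace A};
  us_one : A;
  us_mulP : {in us_space &, forall x y, x * y \in us_space};
  us_oneP : us_one \in us_space;
  us_mul1 : {in us_space, left_id us_one *%R};
  us_mulr1 : {in us_space, right_id us_one *%R}
}.

Definition subalg (U : unital_subspace) : predArgType := subvs_of (us_space U).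

Section Ring.
Variable U : unital_subspace.

HB.instance Definition _ := Vector.on (subalg U).

Definition subalg_val (x : subalg U) : A := vsval x.

Fact subalg_valB x y : subalg_val (x - y) = subalg_val x - subalg_val y.
Proof. by []. Qed.

HB.instance Definition _ := GRing.isZmodMorphism.Build (subalg U) A
  subalg_val subalg_valB.

Fact subalg_val_inj : injective subalg_val.
Proof. exact: val_inj. Qed.

Definition subalg_mul (x y : subalg U) : subalg U :=
  Subvs (us_mulP (subvsP x) (subvsP y)).

Definition subalg_one : subalg U := Subvs (us_oneP U).

Fact subalg_mulA : associative subalg_mul.
Proof. by move=> x y z; apply: subalg_val_inj; apply: mulrA. Qed.

Fact subalg_mul1 : left_id subalg_one subalg_mul.
Proof. by move=> x; apply: subalg_val_inj; apply: us_mul1 (subvsP x). Qed.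

Fact subalg_mulr1 : right_id subalg_one subalg_mul.
Proof. by move=> x; apply: subalg_val_inj; apply: us_mulr1 (subvsP x). Qed.

Fact subalg_mulDl : left_distributive subalg_mul +%R.
Proof. by move=> x y z; apply: subalg_val_inj; apply: mulrDl. Qed.

Fact subalg_mulDr : right_distributive subalg_mul +%R.
Proof. by move=> x y z; apply: subalg_val_inj; apply: mulrDr. Qed.

HB.instance Definition _ := GRing.Zmodule_isPzRing.Build (subalg U)
  subalg_mulA subalg_mul1 subalg_mulr1 subalg_mulDl subalg_mulDr.

Fact subalg_valM x y : subalg_val (x * y) = subalg_val x * subalg_val y.
Proof. by []. Qed.

Fact subalg_val1 : subalg_val 1 = us_one U.
Proof. by []. Qed.

End Ring.

(* A subspace V of A on which R acts by left multiplication through [sb_l]    *)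
(* and S by right multiplication through [sb_r].                              *)
Record mult_bimodule (R S : pzRingType) := MultBimodule {
  mb_space : {vspace A};
  mb_l : {additive R -> A};
  mb_r : {additive S -> A};
  mb_lM : {morph mb_l : x y / x * y};
  mb_rM : {morph mb_r : x y / x * y};
  mb_lP : forall r, {in mb_space, forall x, mb_l r * x \in mb_space};
  mb_rP : forall a, {in mb_space, forall x, x * mb_r a \in mb_space};
  mb_l1 : {in mb_space, forall x, mb_l 1 * x = x};
  mb_r1 : {in mb_space, forall x, x * mb_r 1 = x}
}.

Definition mb_sort R S (X : mult_bimodule R S) : predArgType :=
  subvs_of (mb_space X).

Section Bimodule.
Variables (R S : pzRingType) (X : mult_bimodule R S).

HB.instance Definition _ := GRing.Zmodule.on (mb_sort X).

Definition mb_val (x : mb_sort X) : A := vsval x.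

Fact mb_val_inj : injective mb_val.
Proof. exact: val_inj. Qed.

Definition mb_scale (r : R) (x : mb_sort X) : mb_sort X :=
  Subvs (mb_lP r (subvsP x)).

Definition mb_ract (x : mb_sort X) (a : S) : mb_sort X :=
  Subvs (mb_rP a (subvsP x)).

Fact mb_scaleA r s x : mb_scale r (mb_scale s x) = mb_scale (r * s) x.
Proof. by apply: mb_val_inj; rewrite /mb_val /= mb_lM mulrA. Qed.

Fact mb_scale1 : left_id 1 mb_scale.
Proof. by move=> x; apply: mb_val_inj; apply: mb_l1 (subvsP x). Qed.

Fact mb_scaleDr : right_distributive mb_scale +%R.
Proof. by move=> r x y; apply: mb_val_inj; apply: mulrDr. Qed.

Fact mb_scaleDl x : {morph mb_scale^~ x : r s / r + s}.
Proof.
by move=> r s; apply: mb_val_inj; rewrite /mb_val /= raddfD mulrDl.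
Qed.

HB.instance Definition _ := GRing.Zmodule_isLmodule.Build R (mb_sort X)
  mb_scaleA mb_scale1 mb_scaleDr mb_scaleDl.

Fact mb_ractA x a b : mb_ract (mb_ract x a) b = mb_ract x (a * b).
Proof. by apply: mb_val_inj; rewrite /mb_val /= mb_rM mulrA. Qed.

Fact mb_ract1 x : mb_ract x 1 = x.
Proof. by apply: mb_val_inj; apply: mb_r1 (subvsP x). Qed.

Fact mb_ractDl x y a : mb_ract (x + y) a = mb_ract x a + mb_ract y a.
Proof. by apply: mb_val_inj; apply: mulrDl. Qed.

Fact mb_ractDr x a b : mb_ract x (a + b) = mb_ract x a + mb_ract x b.
Proof. by apply: mb_val_inj; rewrite /mb_val /= raddfD mulrDr. Qed.

Fact mb_ract_scale r x a : r *: mb_ract x a = mb_ract (r *: x) a.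
Proof. by apply: mb_val_inj; apply: mulrA. Qed.

Definition bimodule_of : bimodule R S := @Bimodule R S (mb_sort X) mb_ract
  mb_ractA mb_ract1 mb_ractDl mb_ractDr mb_ract_scale.

End Bimodule.

End UnitalSubspaces.

Section TwistedGroupAlgebra.

Variables (F : fieldType) (H : finGroupType).
Implicit Type beta : H -> H -> F.

Definition scalar_cocycle beta : Prop :=
  (forall a b, beta a b != 0) /\
  (forall a b c,
     beta (a * b)%g c * beta a b = beta a (b * c)%g * beta b c).

Definition scalar_normalized beta : Prop :=
  forall a, beta a 1%g = 1 /\ beta 1%g a = 1.

Variables (beta : H -> H -> F).
Hypotheses (betaZ : scalar_cocycle beta) (betaN : scalar_normalized beta).

Definition tg_bmul (a b : H) : {ffun H -> F^o} := beta a b *: bvec F (a * b)%g.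

Fact tg_bmulA a b c :
  bilin_ext tg_bmul (tg_bmul a b) (bvec F c) =
  bilin_ext tg_bmul (bvec F a) (tg_bmul b c).
Proof.
rewrite bilin_extZl bilin_extZr !bilin_ext_bvec !scalerA -mulgA.
by congr (_ *: _); rewrite mulrC betaZ.2 mulrC.
Qed.

Fact tg_bmul1 a : bilin_ext tg_bmul (bvec F 1%g) (bvec F a) = bvec F a.
Proof. by rewrite bilin_ext_bvec /tg_bmul (betaN a).2 mul1g scale1r. Qed.

Fact tg_bmulr1 a : bilin_ext tg_bmul (bvec F a) (bvec F 1%g) = bvec F a.
Proof. by rewrite bilin_ext_bvec /tg_bmul (betaN a).1 mulg1 scale1r. Qed.

Definition tg_basis_alg : basis_alg F H :=
  BasisAlg tg_bmulA tg_bmul1 tg_bmulr1.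

Definition twisted_group_alg : Type := balg tg_basis_alg.

End TwistedGroupAlgebra.

Section TwistedAlgebra.

Variables (F : fieldType) (gT : finGroupType) (S : finType).
Variable to : {action gT &-> S}.
Implicit Types (g h k l : gT) (s t : S).

(* CS is [{ffun S -> F}] with its pointwise product; the right G-action is    *)
(* the linear extension of e(s)^g = e(sg) (see [idem_act_idem]).              *)
Definition idem s : {ffun S -> F} := [ffun t => (t == s)%:R].

Definition idem_act (x : {ffun S -> F}) g : {ffun S -> F} :=
  [ffun t => x (to t g^-1%g)].

Fact idem_mul s t : idem s * idem t = if s == t then idem t else 0.
Proof.
apply/ffunP=> u; rewrite !ffunE; have [->|st] := eqVneq s t; rewrite !ffunE.
  by case: eqP; rewrite ?mulr1 ?mulr0.
by case: eqP => [->|_]; rewrite ?mul0r // (negPf st) mulr0.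
Qed.

Fact idem_act_idem s g : idem_act (idem s) g = idem (to s g).
Proof.
by apply/ffunP=> t; rewrite !ffunE (canF_eq (actKV to g)).
Qed.

(* The first clause says that the values are units of CS.                     *)
Definition two_cocycle (alpha : gT -> gT -> {ffun S -> F}) : Prop :=
  (forall h k s, alpha h k s != 0) /\
  (forall h k l, alpha (h * k)%g l * idem_act (alpha h k) l =
                 alpha h (k * l)%g * alpha k l).

Definition normalized (alpha : gT -> gT -> {ffun S -> F}) : Prop :=
  forall h, alpha h 1%g = \sum_s idem s /\ alpha 1%g h = \sum_s idem s.

Fact sum_idem t : (\sum_s idem s) t = 1.
Proof.
rewrite sum_ffunE (bigD1 t) //= big1 => [|s /negPf st].
  by rewrite ffunE eqxx addr0.
by rewrite ffunE eq_sym st.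
Qed.

Variable alpha : gT -> gT -> {ffun S -> F}.
Hypotheses (aZ : two_cocycle alpha) (aN : normalized alpha).

Fact cocycleE h k l s :
  alpha (h * k)%g l s * alpha h k (to s l^-1%g) =
  alpha h (k * l)%g s * alpha k l s.
Proof. by have /ffunP/(_ s) := aZ.2 h k l; rewrite !ffunE. Qed.

(* g (x) x for x in CS; the basis vector g (x) e(s) is [bvec F (g, s)].       *)
Definition gtens g (x : {ffun S -> F}) : {ffun gT * S -> F^o} :=
  [ffun p => (p.1 == g)%:R * x p.2].

Fact gtens_idem g s : gtens g (idem s) = bvec F (g, s).
Proof. by apply/ffunP=> -[h t]; rewrite !ffunE xpair_eqE -natrM mulnb. Qed.

Definition tw_bmul (p q : gT * S) : {ffun gT * S -> F^o} :=
  alpha p.1 q.1 q.2 *: gtens (p.1 * q.1)%g (idem (to p.2 q.1) * idem q.2).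

Fact tw_bmulE g s h t : tw_bmul (g, s) (h, t) =
  if to s h == t then alpha g h t *: bvec F ((g * h)%g, t) else 0.
Proof.
rewrite /tw_bmul /= idem_mul; case: eqP => _; first by rewrite gtens_idem.
by rewrite -[RHS](scaler0 _ (alpha g h t)); congr (_ *: _);
  apply/ffunP=> u; rewrite !ffunE mulr0.
Qed.

Definition tw_one : {ffun gT * S -> F^o} := gtens 1%g (\sum_s idem s).

Fact tw_oneE : tw_one = \sum_s bvec F (1%g, s).
Proof.
apply/ffunP=> -[g s]; rewrite ffunE sum_idem mulr1 sum_ffunE (bigD1 s) //=.
rewrite ffunE xpair_eqE eqxx andbT big1 ?addr0 // => t /negPf ts.
by rewrite ffunE xpair_eqE [s == t]eq_sym ts andbF.
Qed.

Fact tw_bmulA p q r :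
  bilin_ext tw_bmul (tw_bmul p q) (bvec F r) =
  bilin_ext tw_bmul (bvec F p) (tw_bmul q r).
Proof.
case: p q r => [g s] [h t] [k u]; rewrite !tw_bmulE.
have -> : bilin_ext tw_bmul
    (if to s h == t then alpha g h t *: bvec F ((g * h)%g, t) else 0)
    (bvec F (k, u)) =
  if to s h == t then alpha g h t *: tw_bmul ((g * h)%g, t) (k, u) else 0.
  by case: ifP => _; rewrite ?bilin_ext0l // bilin_extZl bilin_ext_bvec.
have -> : bilin_ext tw_bmul (bvec F (g, s))
    (if to t k == u then alpha h k u *: bvec F ((h * k)%g, u) else 0) =
  if to t k == u then alpha h k u *: tw_bmul (g, s) ((h * k)%g, u) else 0.
  by case: ifP => _; rewrite ?bilin_ext0r // bilin_extZr bilin_ext_bvec.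
rewrite !tw_bmulE actM; case: (eqVneq (to t k) u) => [tku|_]; last first.
  by case: ifP => _; rewrite ?scaler0.
have -> : (to (to s h) k == u) = (to s h == t).
  by rewrite -tku; apply: (inj_eq (act_inj to k)).
case: eqP => _; last by rewrite scaler0.
rewrite !scalerA mulgA; congr (_ *: _).
have := cocycleE g h k u; rewrite -{2}tku actK => E.
by rewrite mulrC E mulrC.
Qed.

Fact tw_bmul1 p : bilin_ext tw_bmul tw_one (bvec F p) = bvec F p.
Proof.
case: p => g s; rewrite tw_oneE.
rewrite (big_morph (bilin_ext tw_bmul ^~ (bvec F (g, s)))
  (fun x y => bilin_extDl _ x y _) (bilin_ext0l _ _)).
rewrite (bigD1 (to s g^-1%g)) //= big1 => [|t st].
  rewrite bilin_ext_bvec tw_bmulE actKV eqxx (aN g).2 sum_idem mul1g scale1r.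
  by rewrite addr0.
rewrite bilin_ext_bvec tw_bmulE ifN //; apply: contra st => /eqP <-.
by rewrite actK.
Qed.

Fact tw_bmulr1 p : bilin_ext tw_bmul (bvec F p) tw_one = bvec F p.
Proof.
case: p => g s; rewrite tw_oneE.
rewrite (big_morph (bilin_ext tw_bmul (bvec F (g, s)))
  (bilin_extDr _ _) (bilin_ext0r _ _)).
rewrite (bigD1 s) //= big1 => [|t st].
  rewrite bilin_ext_bvec tw_bmulE act1 eqxx (aN g).1 sum_idem mulg1 scale1r.
  by rewrite addr0.
by rewrite bilin_ext_bvec tw_bmulE act1 eq_sym (negPf st).
Qed.

Definition tw_basis_alg : basis_alg F (gT * S)%type :=
  BasisAlg tw_bmulA tw_bmul1 tw_bmulr1.

Definition twisted_alg : Type := balg tw_basis_alg.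

Definition twb g s : twisted_alg := basis tw_basis_alg (g, s).

Fact twb_mul g s h t :
  twb g s * twb h t = if to s h == t then alpha g h t *: twb (g * h)%g t else 0.
Proof. by rewrite [LHS]basis_mul [LHS]tw_bmulE. Qed.

Fact twbV g h s : twb g (to s h^-1%g) * twb h s = alpha g h s *: twb (g * h)%g s.
Proof. by rewrite twb_mul actKV eqxx. Qed.

(* With A_alpha(G, S) = [twisted_alg]: the subspaces S(s), D(s) and D(O_s),   *)
(* then the algebras S(s), D(O_s) and C^{alpha_s}[G_s] as [S_alg], [Dorb] and *)
(* [stab_alg].                                                                *)
Definition S_space s : {vspace twisted_alg} :=
  span_basis _ [pred p | (p.1 \in 'C[s | to]%g) && (p.2 == s)].

Definition D_space s : {vspace twisted_alg} :=
  span_basis _ [pred p | p.2 == s].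

Definition Dorb_space s : {vspace twisted_alg} :=
  span_basis _ [pred p | p.2 \in orbit to setT s].

Fact orbit_setT s g : to s g \in orbit to setT s.
Proof. by apply: mem_orbit; rewrite inE. Qed.

Fact orbit_setTr s t g : (to t g \in orbit to setT s) = (t \in orbit to setT s).
Proof. 
apply/orbitP/orbitP=> -[a _ E]; rewrite ?inE //.
  by exists (a * g^-1)%g; rewrite ?inE // actM E actK.
by exists (a * g)%g; rewrite ?inE // actM E.
Qed.

Fact S_mulP s : {in S_space s &, forall x y, x * y \in S_space s}.
Proof.
apply: span_basis_mul => -[g t] [h u] /andP[/= gs /eqP->] /andP[/= hs /eqP->].
rewrite [_ * _]twb_mul (astab1P hs) eqxx memvZ //.
by apply: basis_in_span; rewrite inE /= groupM ?eqxx.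
Qed.

Fact S_oneP s : twb 1%g s \in S_space s.
Proof. by apply: basis_in_span; rewrite inE /= group1 eqxx. Qed.

Fact S_mul1 s : {in S_space s, left_id (twb 1%g s) *%R}.
Proof.
apply: span_basis_unitl => -[g t] /andP[/= gs /eqP->].
by rewrite [_ * _]twb_mul (astab1P gs) eqxx (aN g).2 sum_idem mul1g scale1r.
Qed.

Fact S_mulr1 s : {in S_space s, right_id (twb 1%g s) *%R}.
Proof.
apply: span_basis_unitr => -[g t] /andP[/= gs /eqP->].
by rewrite [_ * _]twb_mul act1 eqxx (aN g).1 sum_idem mulg1 scale1r.
Qed.

Definition S_alg s : Type :=
  subalg (UnitalSubspace (@S_mulP s) (S_oneP s) (@S_mul1 s) (@S_mulr1 s)).

Definition Dorb_one s : twisted_alg := \sum_(t in orbit to setT s) twb 1%g t.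

Fact Dorb_one_twb s g t :
  t \in orbit to setT s -> Dorb_one s * twb g t = twb g t.
Proof.
move=> ts; rewrite mulr_suml (bigD1 (to t g^-1%g)) ?orbit_setTr //=.
rewrite big1 => [|u /andP[_ ut]].
  by rewrite addr0 twbV (aN g).2 sum_idem mul1g scale1r.
by rewrite twb_mul ifN //; apply: contra ut => /eqP <-; rewrite actK.
Qed.

Fact twb_Dorb_one s g t :
  t \in orbit to setT s -> twb g t * Dorb_one s = twb g t.
Proof.
move=> ts; rewrite mulr_sumr (bigD1 t) //= big1 => [|u /andP[_ ut]].
  by rewrite addr0 twb_mul act1 eqxx (aN g).1 sum_idem mulg1 scale1r.
by rewrite twb_mul act1 ifN // eq_sym.
Qed.

Fact Dorb_mulP s : {in Dorb_space s &, forall x y, x * y \in Dorb_space s}.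
Proof.
apply: span_basis_mul => -[g t] [h u] /= ts us.
rewrite [_ * _]twb_mul; case: eqP => _; last exact: mem0v.
by apply/memvZ/basis_in_span.
Qed.

Fact Dorb_oneP s : Dorb_one s \in Dorb_space s.
Proof. by apply: rpred_sum => t ts; apply: basis_in_span. Qed.

Fact Dorb_mul1 s : {in Dorb_space s, left_id (Dorb_one s) *%R}.
Proof. by apply: span_basis_unitl => -[g t] ts; apply: Dorb_one_twb. Qed.

Fact Dorb_mulr1 s : {in Dorb_space s, right_id (Dorb_one s) *%R}.
Proof. by apply: span_basis_unitr => -[g t] ts; apply: twb_Dorb_one. Qed.

Definition Dorb s : Type :=
  subalg (UnitalSubspace (@Dorb_mulP s) (Dorb_oneP s) (@Dorb_mul1 s)
    (@Dorb_mulr1 s)).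

Definition stab_cocycle s (a b : [subg 'C[s | to]%g]) : F :=
  alpha (sgval a) (sgval b) s.

Fact stab_cocycleZ s : scalar_cocycle (@stab_cocycle s).
Proof.
split=> [a b|a b c]; first exact: aZ.1.
have := cocycleE (sgval a) (sgval b) (sgval c) s.
have -> : to s (sgval c)^-1%g = s by apply/astab1P; rewrite groupV subgP.
by rewrite /stab_cocycle /= => ->.
Qed.

Fact stab_cocycleN s : scalar_normalized (@stab_cocycle s).
Proof.
by move=> a; rewrite /stab_cocycle /= (aN _).1 (aN _).2 !sum_idem.
Qed.

Definition stab_alg s : Type :=
  twisted_group_alg (@stab_cocycleZ s) (@stab_cocycleN s).

(* The identification of S(s) with C^{alpha_s}[G_s], sending a (x) e(s) to    *)
(* the basis element of a.                                                    *)
Definition stab_coord s (x : twisted_alg) : stab_alg s :=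
  [ffun a : [subg 'C[s | to]%g] =>
     (x : {ffun gT * S -> F^o}) (sgval a, s)] : {ffun _ -> F^o}.

Fact stab_coordD s x y :
  stab_coord s (x + y) = stab_coord s x + stab_coord s y.
Proof. by apply/ffunP=> a; rewrite !ffunE. Qed.

Fact stab_coordZ s (k : F) x : stab_coord s (k *: x) = k *: stab_coord s x.
Proof. by apply/ffunP=> a; rewrite !ffunE. Qed.

Fact stab_coord_twb s (a : [subg 'C[s | to]%g]) :
  stab_coord s (twb (sgval a) s) = basis _ a.
Proof.
apply/ffunP=> b; rewrite !ffunE xpair_eqE eqxx andbT.
by rewrite (inj_eq val_inj).
Qed.

Fact stab_coordM s :
  {in S_space s &, {morph stab_coord s : x y / x * y}}.
Proof.
have c0 : stab_coord s 0 = 0 by rewrite -(scale0r 0) stab_coordZ scale0r.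
move=> x y xS yS.
elim/span_basis_ind: x / xS => [|a b Ha Hb|k a Ha|[g t]].
- by rewrite mul0r c0 mul0r.
- by rewrite mulrDl !stab_coordD Ha Hb mulrDl.
- by rewrite -balg_scaleAl !stab_coordZ Ha -balg_scaleAl.
move=> /andP[/= gs /eqP->].
have [c ->] : exists c : [subg 'C[s | to]%g], g = sgval c
  by exists (subg _ g); rewrite subgK.
elim/span_basis_ind: y / yS => [|a b Ha Hb|k a Ha|[h u]].
- by rewrite mulr0 c0 mulr0.
- by rewrite mulrDr !stab_coordD Ha Hb mulrDr.
- by rewrite -balg_scaleAr !stab_coordZ Ha -balg_scaleAr.
move=> /andP[/= hs /eqP->].
have [d ->] : exists d : [subg 'C[s | to]%g], h = sgval d
  by exists (subg _ h); rewrite subgK.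
rewrite [X in stab_coord s X]twb_mul (astab1P (subgP _)) eqxx stab_coordZ.
rewrite [in LHS](stab_coord_twb (c * d)%g).
rewrite ![in RHS]stab_coord_twb.
by rewrite [RHS]basis_mul.
Qed.

Definition stab_iso s (x : S_alg s) : stab_alg s := stab_coord s (subalg_val x).

Fact stab_isoB s x y : stab_iso (x - y) = stab_iso x - stab_iso y :> stab_alg s.
Proof. by apply/ffunP=> a; rewrite !ffunE. Qed.

Fact stab_isoM s : monoid_morphism (@stab_iso s).
Proof.
split=> [|x y]; last by apply: stab_coordM; apply: subvsP.
by rewrite /stab_iso /= [LHS](stab_coord_twb (1%g : [subg 'C[s | to]%g])).
Qed.

HB.instance Definition _ s :=
  GRing.isZmodMorphism.Build (S_alg s) (stab_alg s) (@stab_iso s) (@stab_isoB s).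
HB.instance Definition _ s :=
  GRing.isMonoidMorphism.Build (S_alg s) (stab_alg s) (@stab_iso s) (@stab_isoM s).

Fact stab_iso_inj s : injective (@stab_iso s).
Proof.
move=> x y E; apply/subalg_val_inj/ffunP => -[g t].
have [|gtP] := boolP ((g, t) \in [pred p | (p.1 \in 'C[s | to]%g) && (p.2 == s)]).
  move=> /andP[/= gs /eqP->]; have /ffunP/(_ (subg _ g)) := E.
  by rewrite !ffunE subgK.
rewrite [LHS](mem_span_basis _ _ (subvsP x) _ gtP).
by rewrite [RHS](mem_span_basis _ _ (subvsP y) _ gtP).
Qed.

Fact stab_iso_bij s : bijective (@stab_iso s).
Proof.
pose r (y : stab_alg s) : twisted_alg :=
  \sum_a (y : {ffun _ -> F^o}) a *: twb (sgval a) s.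
have rP y : r y \in S_space s.
  apply: rpred_sum => a _; apply/memvZ/basis_in_span.
  by rewrite inE /= subgP eqxx.
pose f y : S_alg s := Subvs (rP y).
have fK : cancel f (@stab_iso s).
  move=> y; have c0 : stab_coord s 0 = 0.
    by rewrite -(scale0r 0) stab_coordZ scale0r.
  rewrite [RHS]bvec_sum [LHS](big_morph _ (@stab_coordD s) c0).
  by apply: eq_bigr => a _; rewrite stab_coordZ stab_coord_twb.
by exists f => //; apply: inj_can_sym (@stab_iso_inj s).
Qed.

(* D(s) is a left ideal of A_alpha(G, S), hence a left module over both       *)
(* A_alpha(G, S) and D(O_s); S(s) acts on the right.                          *)
Fact D_lP s (a : twisted_alg) :
  {in D_space s, forall x, a * x \in D_space s}.
Proof.
move=> x; apply: (@span_basis_mul _ _ _ predT) => [[g t] [h u] _ /= us|].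
  rewrite [_ * _]twb_mul; case: eqP => _; last exact: mem0v.
  by apply/memvZ/basis_in_span.
by apply/mem_span_basis.
Qed.

Fact D_rP s (a : S_alg s) :
  {in D_space s, forall x, x * subalg_val a \in D_space s}.
Proof.
move=> x xD; apply: span_basis_mul xD (subvsP a) => -[g t] [h u] /= ts.
move=> /andP[/= _ us]; rewrite [_ * _]twb_mul; case: eqP => _; last exact: mem0v.
by apply/memvZ/basis_in_span.
Qed.

Fact D_r1 s : {in D_space s, forall x, x * subalg_val (1 : S_alg s) = x}.
Proof.
apply: span_basis_unitr => -[g t] /eqP /= ->.
by rewrite [_ * _]twb_mul act1 eqxx (aN g).1 sum_idem mulg1 scale1r.
Qed.

Fact D_l1 s : {in D_space s, forall x, subalg_val (1 : Dorb s) * x = x}.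
Proof.
apply: span_basis_unitl => -[g t] /eqP /= ->; apply: Dorb_one_twb.
exact: orbit_refl.
Qed.

Definition D_bimod s : bimodule twisted_alg (S_alg s) :=
  bimodule_of (@MultBimodule F _ tw_basis_alg twisted_alg (S_alg s)
    (D_space s) idfun (@subalg_val _ _ _ _)
    (fun _ _ => erefl) (@subalg_valM _ _ _ _)
    (@D_lP s) (@D_rP s) (fun x _ => mul1r x) (@D_r1 s)).

Definition D_bimod_orb s : bimodule (Dorb s) (S_alg s) :=
  bimodule_of (@MultBimodule F _ tw_basis_alg (Dorb s) (S_alg s)
    (D_space s) (@subalg_val _ _ _ _) (@subalg_val _ _ _ _)
    (@subalg_valM _ _ _ _) (@subalg_valM _ _ _ _)
    (fun r => @D_lP s (subalg_val r)) (@D_rP s) (@D_l1 s) (@D_r1 s)).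

(* Ind_{S(s)}^{D(s)} M = D(s) (x)_{S(s)} M, as a module over A_alpha(G, S),   *)
(* resp. over D(O_s).                                                         *)
Definition Ind s (M : lmodType (stab_alg s)) : lmodType twisted_alg :=
  tensor (D_bimod s) (restr (@stab_iso s) M).

Definition Ind_orb s (M : lmodType (stab_alg s)) : lmodType (Dorb s) :=
  tensor (D_bimod_orb s) (restr (@stab_iso s) M).

End TwistedAlgebra.

(* Main.v *)
(* For s in S the idempotent e = 1 (x) e(s) satisfies D(s) = Ae, S(s) = eAe and
   AeA = D(O_s), so part i) is Morita theory: a nonzero submodule of
   Ae (x)_{eAe} M meets e(Ae (x)_{eAe} M) = e (x) M, hence is everything when M
   is simple; conversely a simple V with eV != 0 receives a nonzero map from
   Ae (x)_{eAe} eV, an isomorphism by Schur's lemma. For part ii), the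
   idempotents 1 (x) e(t) sum to 1, so one of them does not kill V.
   Semisimplicity is Maschke's argument: the basis vectors g (x) e(s) are
   invertible morphisms s -> s g^-1 of a twisted action groupoid, and averaging
   a linear projection over them makes it A-linear. *)
From HB Require Import structures.
Require Import Defs.
From mathcomp Require Import all_boot all_fingroup all_algebra.
From mathcomp Require Import reals complex.
From mathcomp Require boolp.
From mathcomp Require Import freeg.

Set Implicit Arguments.
Unset Strict Implicit.
Unset Printing Implicit Defensive.

Import GRing.Theory Num.Theory.
Local Open Scope ring_scope.

(** * Submodules and Schur's lemma *)

Section Submodules.
Variables (R : pzRingType) (M : lmodType R).
Implicit Types N : {pred M}.

Lemma submod0 N : submod_closed N -> 0 \in N.
Proof. by case. Qed.

Lemma submodD N : submod_closed N -> {in N &, forall x y, x + y \in N}.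
Proof. by move=> [_ NL] x y xN yN; rewrite -[x]scale1r; apply: NL. Qed.

Lemma submodZ N : submod_closed N -> forall a, {in N, forall x, a *: x \in N}.
Proof. by move=> [N0 NL] a x xN; rewrite -[_ *: _]addr0; apply: NL. Qed.

Lemma submodB N : submod_closed N -> {in N &, forall x y, x - y \in N}.
Proof.
by move=> NN x y xN yN; rewrite -scaleN1r; apply: submodD => //; apply: submodZ.
Qed.

Lemma submod_sum N (I : Type) (r : seq I) (P : pred I) (f : I -> M) :
  submod_closed N -> (forall i, P i -> f i \in N) ->
  \sum_(i <- r | P i) f i \in N.
Proof.
move=> NN fN; elim/big_ind: _ => //; first exact: submod0.
by move=> x y; apply: submodD.
Qed.

Lemma simple_nonzero_full N :
  simple_module M -> submod_closed N -> (exists2 x, x \in N & x != 0) ->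
  forall x, x \in N.
Proof.
move=> [_ _ simM] NN [x xN x0] y.
have [//|N0|->//] := simM N NN.
by move: xN; rewrite N0 inE (negPf x0).
Qed.

End Submodules.

(** The kernel is not all of [M] and the image is not zero, so [g] is bijective. The isomorphism
    returned is the inverse of [g], whence the order of [N] and [M] in the conclusion. *)
Lemma schur_iso (R : pzRingType) (M N : lmodType R) (g : {linear M -> N}) :
  simple_module M -> simple_module N -> (exists x, g x != 0) ->
  module_iso N M.
Proof.
move=> simM simN [x0 gx0].
have ginj : injective g.
  have KN : submod_closed ([pred x | g x == 0] : {pred M}).
    split=> [|a u v]; rewrite !inE; first by rewrite linear0.
    by move=> /eqP gu /eqP gv; rewrite linearP gu gv scaler0 addr0.
  have [_ _ /(_ _ KN)[//|K0|KT]] := simM.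
    move=> x y gxy; apply/eqP; rewrite -subr_eq0 -[_ == 0]/(_ \in pred1 0) -K0.
    by rewrite inE linearB gxy subrr.
  by have := KT x0; rewrite !inE (negPf gx0).
have gsurj : forall y, exists x, g x = y.
  pose I : {pred N} := [pred y | boolp.asbool (exists x, g x = y)].
  have IN : submod_closed I.
    split=> [|a u v]; first by apply/boolp.asboolP; exists 0; rewrite linear0.
    move=> /boolp.asboolP[x <-] /boolp.asboolP[y <-]; apply/boolp.asboolP.
    by exists (a *: x + y); rewrite linearP.
  move=> y; apply/boolp.asboolP; apply: (simple_nonzero_full simN IN).
  by exists (g x0) => //; apply/boolp.asboolP; exists x0.
have [h hK] := boolp.choice gsurj.
have hlin : linear h.
  by move=> a u v; apply: ginj; rewrite linearP !hK.
pose H : {linear N -> M} := HB.pack h (GRing.isLinear.Build _ _ _ _ h hlin).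
by exists H, g => x; rewrite /= ?hK //; apply: ginj; rewrite hK.
Qed.

(** * Decomposition into simple submodules *)

Section Decomposition.
Variables (R : pzRingType) (M : lmodType R) (d : {pred M} -> nat).
Hypothesis d_lt : forall N N' : {pred M}, submod_closed N -> submod_closed N' ->
  {subset N <= N'} -> ~ N =i N' -> (d N < d N')%N.
Hypothesis complemented : forall N : {pred M}, submod_closed N ->
  exists p : M -> M,
    [/\ linear p, forall x, p x \in N & {in N, forall x, p x = x}].

(** Descent on [d], a rank that grows strictly along proper inclusions of submodules and so stands
    for finite length. *)
Lemma exists_simple_submod (N : {pred M}) :
  submod_closed N -> (exists2 x, x \in N & x != 0) ->
  exists2 L : {pred M}, simple_submod L & {subset L <= N}.
Proof.
have [n] := ubnP (d N); elim: n N => // n IHn N dN NN N_neq0.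
have [simN|nsimN] := boolp.pselect (simple_submod N); first by exists N.
have [N' [N'N sN' N'0 N'T]] : exists N' : {pred M},
  [/\ submod_closed N', {subset N' <= N}, ~ N' =i pred1 0 & ~ N' =i N].
  apply: boolp.contrapT => noN'; apply: nsimN; split=> // N' N'N sN'.
  have [?|N'0] := boolp.pselect (N' =i pred1 0); first by left.
  have [?|N'T] := boolp.pselect (N' =i N); first by right.
  by case: noN'; exists N'.
have [|//||L simL LN'] := IHn N'.
- by rewrite -ltnS; apply: leq_trans dN; rewrite ltnS d_lt.
- apply: boolp.contrapT => no_x; apply: N'0 => x; apply/idP/eqP => [xN'|->].
    by apply: boolp.contrapT => /eqP x0; apply: no_x; exists x.
  exact: submod0.
- by exists L => // x /LN'/sN'.
Qed.

(** Split off a simple submodule and recurse on the part of [N] killed by the projection onto it,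
    where [d] is smaller. *)
Lemma simple_decomposition (N : {pred M}) :
  submod_closed N ->
  exists (n : nat) (L : 'I_n -> {pred M}),
    (forall i, simple_submod (L i)) /\
    {in N, forall x, exists! c : {ffun 'I_n -> M},
        (forall i, c i \in L i) /\ x = \sum_i c i} /\
    (forall i, {subset L i <= N}).
Proof.
have [n] := ubnP (d N); elim: n N => // n IHn N dN NN.
have [N0|[x0 x0N x0n0]] : {in N, forall x, x = 0} \/ exists2 x, x \in N & x != 0.
- have [ex|nex] := boolp.pselect (exists2 x, x \in N & x != 0); first by right.
  left=> x xN; apply: boolp.contrapT => /eqP x0; apply: nex; by exists x.
(* The family is empty, so [fun=> N] is a dummy. *)
- exists 0, (fun=> N); split; first by case.
  split; last by case.
  move=> x /N0 ->; exists [ffun=> 0]; split.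
    by split; [case | rewrite big_ord0].
  by move=> c _; apply/ffunP=> -[].
have [|L0 simL0 L0N] := exists_simple_submod NN; first by exists x0.
have [L0L [y0 y0L y0n0] _] := simL0.
have [p [plin pL pK]] := complemented L0L.
have pB : {morph p : x y / x - y}.
  by move=> x y; rewrite -scaleN1r addrC plin scaleN1r addrC.
have p0 : p 0 = 0 by have := pB 0 0; rewrite !subrr.
have pD : {morph p : x y / x + y}.
  by move=> x y; have := plin 1 x y; rewrite !scale1r.
(* A complement of [L0] in [N]: as [L0] lies in [N], so does [x - p x] for [x] in [N]. *)
pose N1 : {pred M} := [pred x | (x \in N) && (p x == 0)].
have N1N : submod_closed N1.
  split=> [|a u v]; first by rewrite inE submod0 //= p0.
  move=> /andP[uN /eqP pu] /andP[vN /eqP pv].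
  by rewrite inE plin pu pv scaler0 addr0 eqxx andbT NN.2.
have sN1 : {subset N1 <= N} by move=> x /andP[].
have [|//|m [L [simL [decL LN1]]]] := IHn N1.
  rewrite -ltnS; apply: leq_trans dN; rewrite ltnS d_lt // => /(_ y0).
  by rewrite inE pK // (negPf y0n0) andbF L0N.
(* Index 0 carries [L0]; the later indices carry the family found for [N1]. *)
exists m.+1, (fun i => oapp L L0 (unlift ord0 i)); split.
  by move=> i; case: unliftP => [j|] _ /=.
split; last first.
  by move=> i; case: unliftP => [j|] _ //= x /LN1/sN1.
move=> x xN.
have x1N1 : x - p x \in N1.
  by rewrite inE submodB ?(L0N (p x)) //= pB [p (p x)]pK // subrr.
have [c [[cL cE] cU]] := decL _ x1N1.
exists [ffun i => oapp c (p x) (unlift ord0 i)]; split.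
  split=> [i|]; first by rewrite ffunE; case: unliftP => [j|] _ /=; rewrite ?cL ?pL.
  rewrite big_ord_recl ffunE unlift_none /=.
  under eq_bigr do rewrite ffunE liftK /=.
  by rewrite -cE addrC subrK.
(* The tail of any decomposition lies in [N1], where [p] vanishes, so applying [p] isolates the
   component in [L0]. *)
move=> c' [c'L xE]; rewrite big_ord_recl in xE.
have pc' (j : 'I_m) : p (c' (fintype.lift ord0 j)) = 0.
  have := c'L (fintype.lift ord0 j); rewrite liftK /= => /LN1.
  by case/andP => _ /eqP.
have c'0 : c' ord0 = p x.
  rewrite xE pD (big_morph p pD p0) big1 // addr0 pK //.
  by have := c'L ord0; rewrite unlift_none.
have Ec : c = [ffun j => c' (fintype.lift ord0 j)].
  apply: cU; split=> [j|].
    by rewrite ffunE; have := c'L (fintype.lift ord0 j); rewrite liftK.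
  under eq_bigr do rewrite ffunE.
  by apply: (addrI (p x)); rewrite addrC subrK {1}xE c'0.
apply/ffunP=> i; rewrite ffunE; case: unliftP => [j ->|->] /=.
  by rewrite Ec ffunE.
by rewrite c'0.
Qed.

End Decomposition.

(** * Dimension as a rank on submodules of a vector space *)

Section VectorSubspaces.
Variables (F : fieldType) (V : vectType F).

(** A subspace of maximal dimension inside [N] contains every [x] in [N], since adding the line
    through [x] cannot raise its dimension. *)
Lemma vspace_of_submod (N : {pred V}) :
  submod_closed N -> exists U : {vspace V}, U =i N.
Proof.
move=> NN.
pose P n := boolp.asbool (exists2 U : {vspace V}, {subset U <= N} & \dim U = n).
have P0 : exists n, P n.
  exists 0%N; apply/boolp.asboolP; exists 0%VS; last exact: dimv0.
  by move=> x; rewrite memv0 => /eqP ->; apply: submod0.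
have Pmax n : P n -> (n <= \dim {:V})%N.
  by move=> /boolp.asboolP[U _ <-]; apply/dimvS/subvf.
have [n /boolp.asboolP[U UN dU] nmax] := ex_maxnP P0 Pmax.
exists U => x; apply/idP/idP => [/UN//|xN].
have : (\dim (U + <[x]>)%VS <= \dim U)%N.
  rewrite dU; apply: nmax; apply/boolp.asboolP; exists (U + <[x]>)%VS => //.
  move=> _ /memv_addP[u uU [_ /vlineP[k ->] ->]].
  by apply: submodD => //; [apply: UN | apply: submodZ].
have := dimv_leqif_eq (addvSl U <[x]>) => E; rewrite (geq_leqif E) => /eqP ->.
by rewrite (subvP (addvSr _ _)) ?memv_line.
Qed.

Lemma submod_dim : exists d : {pred V} -> nat,
  forall N N' : {pred V}, submod_closed N -> submod_closed N' ->
  {subset N <= N'} -> ~ N =i N' -> (d N < d N')%N.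
Proof.
have ex N : exists U : {vspace V}, submod_closed N -> U =i N.
  have [/vspace_of_submod[U UE]|nN] := boolp.pselect (submod_closed N).
    by exists U.
  (* Default value for predicates that are not submodules. *)
  by exists 0%VS.
have [U UE] := boolp.choice ex; exists (fun N => \dim (U N)).
move=> N N' NN NN' sNN' neN.
have sU : (U N <= U N')%VS by apply/subvP=> x; rewrite !UE //; apply: sNN'.
rewrite (ltn_leqif (dimv_leqif_sup sU)); apply/negP => /subvP sU'.
apply: neN => x; apply/idP/idP => [/sNN'//|].
by rewrite -(UE _ NN') -(UE _ NN); apply: sU'.
Qed.

End VectorSubspaces.

(** * The universal property of the tensor product *)

Section TensorLift.
Variables (R S : pzRingType) (B : bimodule R S) (M : lmodType S).
Variables (W : zmodType) (f : B -> M -> W).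
Hypothesis fDl : forall x y m, f (x + y) m = f x m + f y m.
Hypothesis fDr : forall x m n, f x (m + n) = f x m + f x n.
Hypothesis f_bal : forall x a m, f (Defs.ract x a) m = f x (a *: m).

(** The extension of [f] to the free abelian group kills the relators, hence the subgroup they
    generate, and so factors through the quotient. *)
Lemma tensor_lift : exists g : tensor B M -> W,
  (forall t u, g (t - u) = g t - g u) /\ forall x m, g (tens x m) = f x m.
Proof.
pose h : {freeg (B * M)%type / int} -> zmodule W :=
  fglift (fun xm : B * M => f xm.1 xm.2 : zmodule W).
have hB z w : h (z - w) = h z - h w by apply: lift_is_additive.
have h_gen x m : h (gen x m) = f x m by rewrite /h liftU scale1r.
have h_rel z : z \in tensor_rel (B := B) (M := M) -> h z = 0.
  move=> zrel; apply/eqP; rewrite -[_ == _]/(z \in [pred z | h z == 0]).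
  apply: tensor_rel_min z zrel.
    have h0 : h 0 = 0 by have := hB 0 0; rewrite !subrr.
    split=> [|u v]; rewrite !inE ?h0 // => /eqP hu /eqP hv.
    by rewrite hB hu hv subrr.
  move=> r; rewrite inE => -[x y m|x m n|x a m]; rewrite !hB !h_gen.
  - by rewrite fDl -addrA -opprD subrr.
  - by rewrite fDr -addrA -opprD subrr.
  - by rewrite f_bal subrr.
pose g (t : tensor B M) : W :=
  h (generic_quotient.repr (t : Quotient.quot (tensor_rel (B := B) (M := M)))).
have g_pi z : g (tens_pi z) = h z.
  apply/eqP; rewrite -subr_eq0; apply/eqP; rewrite -[LHS]hB; apply: h_rel.
  apply/tens_piP.
  exact: (@generic_quotient.reprK _ (Quotient.quot (tensor_rel (B:=B) (M:=M))) _).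
exists g; split=> [t u|x m]; last by rewrite g_pi h_gen.
elim/tens_piW: t => z; elim/tens_piW: u => w.
by rewrite -raddfB !g_pi hB.
Qed.

End TensorLift.

(** * Simplicity of induced modules *)

(* The model is B = Re and S = eRe, with [e0] = e in B and [tau] x = ex; the
   family [u] shows that ReR acts unitally on B. *)
Section InducedSimple.
Variables (R S : pzRingType) (B : bimodule R S) (e : R) (e0 : B).
Variables (I : finType) (u : I -> R) (tau : B -> S).
Hypothesis e0_gen : forall x : B, exists r, x = r *: e0.
Hypothesis e_ract : forall x : B, exists a, e *: x = Defs.ract e0 a.
Hypothesis u_two_sided : forall i, exists c d, u i = c * e * d.
Hypothesis u_sum : forall x : B, \sum_i u i *: x = x.
Hypothesis tauD : forall x y, tau (x + y) = tau x + tau y.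
Hypothesis tau_ract : forall x a, tau (Defs.ract x a) = tau x * a.
Hypothesis tau_e0 : tau e0 = 1.

(** For [t] nonzero in a submodule, some [u i *: t] is nonzero; writing [u i] as c e d shows that e
    d t is a nonzero [tens e0 m] in the submodule. The [m] that occur in this way form a submodule
    of [M], hence all of [M], and [e0] generates [B]. *)
Lemma ind_simple (M : lmodType S) :
  simple_module M -> simple_module (tensor B M).
Proof.
move=> simM.
have tens0r (x : B) : tens x (0 : M) = 0.
  by apply: (addrI (tens x 0)); rewrite -tensDr !addr0.
have e_tens (t : tensor B M) : exists m, e *: t = tens e0 m.
  elim/tensor_ind: t => [x m|t t' [m Em] [m' Em']].
    by have [a Ea] := e_ract x; exists (a *: m); rewrite scale_tens Ea tens_bal.
  exists (m - m'); rewrite scalerBr Em Em'.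
  by apply/eqP; rewrite subr_eq -tensDr subrK.
have u_tens (t : tensor B M) : \sum_i u i *: t = t.
  elim/tensor_ind: t => [x m|t t' Et Et'].
    rewrite -[in RHS](u_sum x).
    have tens0l : tens 0 m = 0 :> tensor B M.
      by apply: (addrI (tens 0 m)); rewrite -tensDl !addr0.
    rewrite (big_morph (fun x => tens x m) (fun x y => tensDl x y m) tens0l).
    by apply: eq_bigr => i _; rewrite scale_tens.
  rewrite -[in RHS]Et -[in RHS]Et' -sumrB.
  by apply: eq_bigr => i _; rewrite scalerBr.
(* [tau] induces a map from the tensor product to [M] that is a left inverse of [m] to
   [tens e0 m]. *)
have e0_inj m : tens e0 m = 0 -> m = 0 :> M.
  have [||x a m'|g [gB gE]] := @tensor_lift _ _ B M M (fun x m => tau x *: m).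
  - by move=> x y m'; rewrite tauD scalerDl.
  - by move=> x m' n; rewrite scalerDr.
  - by rewrite tau_ract scalerA.
  have g0 : g 0 = 0 by have := gB 0 0; rewrite !subrr.
  by move=> /(congr1 g); rewrite gE g0 tau_e0 scale1r.
have [_ [m0 _ m0n0] _] := simM.
split=> [|/=|N' NN' _]; first by split.
  by exists (tens e0 m0) => //; apply: contraNneq m0n0 => /e0_inj ->.
have [[t tN' t0]|N'0] :=
    boolp.pselect (exists2 t : tensor B M, t \in N' & t != 0); last first.
  left=> t; rewrite [RHS]inE; apply/idP/eqP => [tN'|->]; last exact: submod0.
  by apply: boolp.contrapT => /eqP t0; apply: N'0; exists t.
right; have [i uit0] : exists i, u i *: t != 0.
  apply: boolp.contrapT => ut0; move: t0; rewrite -(u_tens t) big1 ?eqxx //.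
  by move=> i _; apply: boolp.contrapT => /eqP uit; apply: ut0; exists i.
have [c [d Eu]] := u_two_sided i.
have [m Em] := e_tens (d *: t).
have mN' : tens e0 m \in N' by rewrite -Em; do 2!apply: submodZ => //.
have mn0 : m != 0.
  apply: contraNneq uit0 => m0'.
  by rewrite Eu -!scalerA Em m0' tens0r scaler0.
have N0N : submod_closed ([pred m | tens e0 m \in N'] : {pred M}).
  split=> [|a m1 m2]; rewrite !inE; first by rewrite tens0r submod0.
  move=> m1N m2N; rewrite tensDr submodD // -tens_bal.
  (* To absorb the scalar [a], move it across the tensor sign onto [e0] and rewrite the result as a
     left multiple of [e0]. *)
  have [r ->] := e0_gen (Defs.ract e0 a).
  by rewrite -scale_tens submodZ.
have mT := simple_nonzero_full simM N0N (ex_intro2 _ _ m mN' mn0).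
move=> t'; rewrite [RHS]inE; elim/tensor_ind: t' => [x m'|t1 t2 t1N t2N].
  have [r ->] := e0_gen x; rewrite -scale_tens submodZ //.
  exact: (mT m').
by apply: submodB.
Qed.

End InducedSimple.

(** * The corner eV of a module V *)

(* A multiplicative map need not be unital: [f 1] is an idempotent e of R, and
   [corner_module f V] below is eV as a T-module. *)
Record corner_map (T R : pzRingType) := CornerMap {
  corner_fun :> T -> R;
  corner_mapD : {morph corner_fun : a b / a + b};
  corner_mapM : {morph corner_fun : a b / a * b}
}.

(** Since [f 1] is idempotent, its image eV is its set of fixed points, and the equation gives a
    decidable predicate. *)
Definition corner_pred (T R : pzRingType) (f : corner_map T R)
    (V : lmodType R) : {pred V} := [pred v | f 1 *: v == v].
Arguments corner_pred {T R} f V _.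

Section CornerPred.
Variables (T R : pzRingType) (f : corner_map T R) (V : lmodType R).

Fact corner_pred_closed : zmod_closed (corner_pred f V).
Proof.
split=> [|x y]; rewrite !inE ?scaler0 // => /eqP Ex /eqP Ey.
by rewrite scalerBr Ex Ey.
Qed.

HB.instance Definition _ :=
  GRing.isZmodClosed.Build V (corner_pred f V) corner_pred_closed.
End CornerPred.

Record corner_module (T R : pzRingType) (f : corner_map T R)
    (V : lmodType R) := CornerModule {
  corner_val : V;
  corner_valP : corner_val \in corner_pred f V
}.

Section CornerModule.
Variables (T R : pzRingType) (f : corner_map T R) (V : lmodType R).
Local Notation W := (corner_module f V).

HB.instance Definition _ := [isSub for @corner_val T R f V].
HB.instance Definition _ := [Choice of W by <:].
HB.instance Definition _ := [SubChoice_isSubZmodule of W by <:].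

Fact corner_scale_subproof (a : T) (v : W) :
  f a *: val v \in corner_pred f V.
Proof. by rewrite inE scalerA -corner_mapM mul1r. Qed.

Definition corner_scale (a : T) (v : W) : W :=
  CornerModule (corner_scale_subproof a v).

Fact corner_scaleA a b v :
  corner_scale a (corner_scale b v) = corner_scale (a * b) v.
Proof. by apply: val_inj; rewrite /= scalerA corner_mapM. Qed.

Fact corner_scale1 : left_id 1 corner_scale.
Proof. by move=> v; apply: val_inj; apply/eqP; apply: corner_valP v. Qed.

Fact corner_scaleDr : right_distributive corner_scale +%R.
Proof. by move=> a u v; apply: val_inj; rewrite /= scalerDr. Qed.

Fact corner_scaleDl v : {morph corner_scale^~ v : a b / a + b}.
Proof. by move=> a b; apply: val_inj; rewrite /= corner_mapD scalerDl. Qed.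

HB.instance Definition _ := GRing.Zmodule_isLmodule.Build T W
  corner_scaleA corner_scale1 corner_scaleDr corner_scaleDl.

Lemma corner_valZ a (v : W) : val (a *: v) = f a *: val v.
Proof. by []. Qed.

Hypothesis f_corner : forall r, exists a, f a = f 1 * r * f 1.

(** A nonzero submodule [N] of eV is contained in the submodule [N'] of [V] formed by the v with eRv
    inside [N]. Then [N'] is all of [V], and r = 1 puts each w = ew of eV into [N]. *)
Lemma corner_simple :
  simple_module V -> (exists v : V, f 1 *: v != 0) ->
  simple_module (corner_module f V).
Proof.
move=> simV [v0 v0n0].
have f11 : f 1 * f 1 = f 1 by rewrite -corner_mapM mulr1.
have v0P : f 1 *: v0 \in corner_pred f V by rewrite inE scalerA f11.
split=> [|/=|N NN _]; first by split.
  by exists (CornerModule v0P) => //; apply: contraNneq v0n0 => /(congr1 val) /= ->.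
have [[n nN n0]|N0] := boolp.pselect (exists2 n, n \in N & n != 0); last first.
  left=> n; rewrite [RHS]inE; apply/idP/eqP => [nN|->]; last exact: submod0.
  by apply: boolp.contrapT => /eqP n0; apply: N0; exists n.
right=> w; rewrite [RHS]inE.
pose N' : {pred V} := [pred v | boolp.asbool
  (forall r, exists2 m, m \in N & val m = f 1 *: (r *: v))].
have NN' : submod_closed N'.
  split=> [|a v v']; rewrite !inE.
    apply/boolp.asboolP => r; exists 0; first exact: submod0.
    by rewrite !scaler0.
  move=> /boolp.asboolP vN /boolp.asboolP v'N; apply/boolp.asboolP => r.
  have [m mN Em] := vN (r * a); have [m' m'N Em'] := v'N r.
  exists (m + m'); first exact: submodD.
  by rewrite raddfD /= Em Em' -scalerA !scalerDr.
have : val w \in N'.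
  apply: (simple_nonzero_full simV NN'); exists (val n); last first.
    by apply: contraNneq n0 => n0; apply/eqP/val_inj; rewrite n0.
  (* As n = en, the vector e r n equals e r e n, and e r e comes from [T] by [f_corner]. *)
  apply/boolp.asboolP => r; have [a Ea] := f_corner r.
  exists (a *: n); first exact: submodZ.
  rewrite corner_valZ Ea -!scalerA; do 2!congr (_ *: _).
  exact/eqP/(corner_valP n).
move=> /boolp.asboolP/(_ 1)[m mN Em].
suff -> : w = m by [].
apply: val_inj; rewrite Em scale1r.
by apply/esym/eqP; apply: (corner_valP w).
Qed.

End CornerModule.

Section InducedFromCorner.
Variables (R S T : pzRingType) (sg : {rmorphism S -> T}) (B : bimodule R S).
Variables (f : corner_map T R) (j : B -> R) (e0 : B).
Hypothesis jD : {morph j : x y / x + y}.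
Hypothesis jZ : forall r x, j (r *: x) = r * j x.
Hypothesis j_ract : forall x a, j (Defs.ract x a) = j x * f (sg a).
Hypothesis j_e0 : j e0 = f 1.

(** With [j] identifying [B] with Re inside [R], the multiplication map from the tensor product of
    [B] and eV to [V] is linear and nonzero, so Schur's lemma applies. *)
Lemma corner_ind_iso (V : lmodType R) :
  simple_module V -> (exists v : V, f 1 *: v != 0) ->
  simple_module (tensor B (restr sg (corner_module f V))) ->
  module_iso V (tensor B (restr sg (corner_module f V))).
Proof.
move=> simV [v v0] simT.
have [x y m|x m n|x a m|g [gB gE]] :=
  @tensor_lift _ _ B (restr sg (corner_module f V)) V
    (fun x m => j x *: corner_val (m : corner_module f V)).
- by rewrite jD scalerDl.
- by rewrite -scalerDr.
- by rewrite j_ract -scalerA.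
have glin : linear g.
  move=> r t u; have g0 : g 0 = 0 by have := gB 0 0; rewrite !subrr.
  (* Additivity follows from [gB]; what remains is compatibility with scalars, checked on
     generators. *)
  have -> : g (r *: t) = r *: g t -> g (r *: t + u) = r *: g t + g u.
    by move=> <-; rewrite -[u in LHS]opprK gB -[- u]sub0r gB g0 sub0r opprK.
  by [].
  elim/tensor_ind: t => [x m|t t' Et Et'].
    by rewrite scale_tens !gE jZ scalerA.
  by rewrite scalerBr !gB Et Et' scalerBr.
pose G : {linear tensor B (restr sg (corner_module f V)) -> V} :=
  HB.pack g (GRing.isLinear.Build _ _ _ _ g glin).
apply: (@schur_iso _ _ _ G) => //.
have vP : f 1 *: v \in corner_pred f V.
  by rewrite inE scalerA -corner_mapM mulr1.
exists (tens e0 (CornerModule vP : restr sg (corner_module f V))).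
by rewrite /= gE j_e0 /= scalerA -corner_mapM mulr1.
Qed.

End InducedFromCorner.

Lemma restr_simple (T T' : pzRingType) (sg : {rmorphism T -> T'})
    (sg_surj : forall b, exists a, sg a = b) (M : lmodType T') :
  simple_module M -> simple_module (restr sg M).
Proof.
move=> [_ [x _ x0] simM]; split=> [|/=|N [N0 NL] _]; first by split.
  by exists x.
apply: (simM N) => //; split=> // b u v uN vN.
by have [a <-] := sg_surj b; apply: (NL a u v).
Qed.

(** * Maschke's theorem for the twisted action groupoid *)

Section TwistedAlgebraTheory.
Variables (F : fieldType) (gT : finGroupType) (S : finType).
Variables (to : {action gT &-> S}) (alpha : gT -> gT -> {ffun S -> F}).
Hypotheses (aZ : two_cocycle to alpha) (aN : normalized alpha).
Local Notation A := (twisted_alg aZ aN).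
Local Notation twb := (twb aZ aN).
Implicit Types (g h : gT) (s t : S).

Lemma sum_twb1 : \sum_s twb 1%g s = 1 :> A.
Proof. exact/esym/tw_oneE. Qed.

(** The inverse morphism in the groupoid; the scalar makes the product [twb g s * twb_inv g s]
    exactly an idempotent basis vector. *)
Definition twb_inv g s : A :=
  (alpha g g^-1%g (to s g^-1%g))^-1 *: twb g^-1%g (to s g^-1%g).

Lemma twb_mulV g s : twb g s * twb_inv g s = twb 1%g (to s g^-1%g).
Proof.
rewrite -[LHS]balg_scaleAr twb_mul eqxx scalerA mulVf ?aZ.1 // scale1r.
by rewrite mulgV.
Qed.

Lemma cocycle_normr g s : alpha g 1%g s = 1.
Proof. by rewrite (aN g).1 sum_idem. Qed.

Lemma cocycle_norml g s : alpha 1%g g s = 1.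
Proof. by rewrite (aN g).2 sum_idem. Qed.

(** The scalar [alpha h g s] is the one in the product of [twb h t] and [twb g s]; this match makes
    the average in [maschke] equivariant. *)
Lemma twb_inv_mul h g s t :
  twb_inv (h * g)%g s * twb h t =
  if to t g == s then alpha h g s *: twb_inv g s else 0.
Proof.
rewrite -[LHS]balg_scaleAl twb_mul -actM invMg mulgKV.
rewrite (canF_eq (actK to g)) eq_sym; case: eqP => [Et|_]; last by rewrite scaler0.
rewrite /twb_inv -Et !scalerA; congr (_ *: _).
have Es : s = to t g by rewrite Et actKV.
rewrite actM -Et.
(* Cocycle identities at [t] for the triples (h, g, g^-1) and (hg, (hg)^-1, h); normalization
   trivializes one factor of each. *)
have := cocycleE aZ h g g^-1%g t; rewrite invgK -Es mulgV cocycle_normr mul1r => E1.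
have := cocycleE aZ (h * g)%g (h * g)^-1%g h t.
rewrite mulgV cocycle_norml mul1r invMg mulgKV => E2.
by rewrite E2 -E1 !invfM divfK ?aZ.1 // mulrCA mulfV ?aZ.1 // mulr1.
Qed.

Lemma scale_submod (N : {pred A^o}) :
  submod_closed N -> submod_closed (N : {pred A}).
Proof.
move=> [N0 NL]; split=> // k u v uN vN.
by rewrite -[u]mul1r balg_scaleAl; apply: NL.
Qed.

Lemma maschke (N : {pred A^o}) : #|gT|%:R != 0 :> F -> submod_closed N ->
  exists p : A^o -> A^o,
    [/\ linear p, forall x, p x \in N & {in N, forall x, p x = x}].
Proof.
move=> charF NN; have [U UE] := vspace_of_submod (scale_submod NN).
pose q (x : A) : A := \sum_g \sum_s twb g s * projv U (twb_inv g s * x).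
have qB : {morph q : x y / x + y}.
  move=> x y; rewrite -big_split; apply: eq_bigr => g _ /=.
  rewrite -big_split; apply: eq_bigr => s _ /=.
  by rewrite mulrDr linearD mulrDr.
have qZ k x : q (k *: x) = k *: q x.
  rewrite scaler_sumr; apply: eq_bigr => g _.
  rewrite scaler_sumr; apply: eq_bigr => s _.
  by rewrite -balg_scaleAr linearZ /= -balg_scaleAr.
(* After reindexing by g to hg, both sides agree term by term: each is zero unless tg = s, and
   otherwise carries the scalar [alpha h g s]. *)
have q_twb h t x : q (twb h t * x) = twb h t * q x.
  rewrite {1}/q (reindex_inj (mulgI h)) mulr_sumr; apply: eq_bigr => g _.
  rewrite mulr_sumr; apply: eq_bigr => s _.
  rewrite !mulrA twb_inv_mul twb_mul; case: eqP => _.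
    by rewrite -!balg_scaleAl linearZ /= -balg_scaleAr.
  by rewrite !mul0r linear0 mulr0.
have qM a x : q (a * x) = a * q x.
  have q0 : q 0 = 0 by have := qZ 0 0; rewrite !scale0r.
  elim/bvec_ind: a => [|a b Ea Eb|k a Ea|[g s]].
  - by rewrite !mul0r q0.
  - by rewrite !mulrDl qB Ea Eb.
  - by rewrite -!balg_scaleAl qZ Ea.
  - exact: q_twb.
exists (fun x => #|gT|%:R^-1 *: q x); split=> [a u v|x|x xN].
- rewrite qB -[q (a *: u)]/(q (a * u)) qM scalerDr.
  by congr (_ + _); apply: balg_scaleAr.
- apply: (submodZ (scale_submod NN)); apply: (submod_sum _ (scale_submod NN)).
  move=> g _; apply: (submod_sum _ (scale_submod NN)) => s _; apply: (submodZ NN).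
  by rewrite -UE memv_proj.
(* On [N] the projection is the identity, and for each fixed g the products [twb g s * twb_inv g s]
   sum over s to 1, so each g contributes [x]. *)
have -> : q x = (#|gT|%:R : F) *: (x : A).
  rewrite scaler_nat -sumr_const; apply: eq_bigr => g _.
  rewrite -[RHS]mul1r -sum_twb1 mulr_suml (reindex_inj (act_inj to g)) /=.
  apply: eq_bigr => s _.
  rewrite projv_id ?mulrA ?twb_mulV ?actK // UE.
  exact: (submodZ NN).
by rewrite scalerA mulVf // scale1r.
Qed.

Lemma twisted_alg_semisimple : #|gT|%:R != 0 :> F -> semisimple_ring A.
Proof.
move=> charF; have [d d_lt] := submod_dim A.
have [||//|n [L [simL [decL _]]]] := @simple_decomposition A A^o d _ _ predT.
- by move=> N N' /scale_submod NN /scale_submod NN'; apply: d_lt.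
- by move=> N; apply: maschke.
by exists n, L; split=> // x; apply: decL.
Qed.

Lemma Dorb_lmul s a : {in Dorb_space aZ aN s, forall x, a * x \in Dorb_space aZ aN s}.
Proof.
move=> x; apply: (@span_basis_mul _ _ _ predT) => [[g t] [h u] _ /= us|].
  rewrite [_ * _]twb_mul; case: eqP => _; last exact: mem0v.
  by apply/memvZ/basis_in_span.
by apply/mem_span_basis.
Qed.

(* Left ideals of D(O_s) are left ideals of A, as D(O_s) is an ideal with
   identity. *)
Lemma Dorb_semisimple s : #|gT|%:R != 0 :> F -> semisimple_ring (Dorb aZ aN s).
Proof.
move=> charF; pose D := Dorb aZ aN s; have [d d_lt] := submod_dim A.
pose U := Dorb_space aZ aN s.
pose im (N : {pred D^o}) : {pred A^o} :=
  [pred x | (x \in U) && ((vsproj U x : D) \in N)].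
have im_val N (x : D) : (subalg_val x \in im N) = (x \in N).
  by rewrite inE /= subvsP /= [vsproj _ _]vsvalK.
have imN N : submod_closed N -> submod_closed (im N).
  move=> NN; split=> [|a u v]; first by rewrite inE mem0v linear0; apply: (submod0 NN).
  move=> /andP[uU uN] /andP[vU vN].
  (* On elements of D(O_s), [a] acts as its product with the identity of D(O_s), which lies in
     D(O_s). *)
  have aU : a * Dorb_one aZ aN s \in U by apply/Dorb_lmul/Dorb_oneP.
  have -> : a *: u + v =
      subalg_val ((vsproj U (a * Dorb_one aZ aN s) : D) * vsproj U u + vsproj U v).
    rewrite raddfD /= /subalg_val !vsprojK //.
    by rewrite -mulrA Dorb_mul1.
  by rewrite im_val; apply: NN.2.
have [||//|n [L [simL [decL _]]]] :=
  @simple_decomposition D D^o (d \o im) _ _ predT.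
- move=> N N' NN NN' sNN' neN; apply: d_lt.
  + exact/scale_submod/imN.
  + exact/scale_submod/imN.
  + by move=> x /andP[xU xN]; rewrite inE xU sNN'.
  by move=> imE; apply: neN => x; rewrite -!im_val.
- move=> N NN; have [p [plin pN pK]] := maschke charF (imN N NN).
  have pU x : p x \in U by have /andP[] := pN x.
  exists (fun x : D => vsproj U (p (subalg_val x)) : D); split=> [a u v|x|x xN].
  + apply: subalg_val_inj; rewrite raddfD /= /subalg_val !vsprojK //.
    exact: plin.
  + by rewrite -im_val /subalg_val vsprojK.
  by rewrite pK ?im_val // vsvalK.
by exists n, L; split=> // x; apply: decL.
Qed.

(** * Induction from S(s), over A and over D(O_s) at once *)

(* A common frame for R = A_alpha(G, S) and R = D(O_s), the latter embedded in
   A by [l]; [pr] inverts [l] on D(O_s). *)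
Section Induction.
Variables (s : S) (R : pzRingType) (l : {additive R -> A}) (pr : A -> R).
Hypotheses (lM : {morph l : x y / x * y}) (l_inj : injective l).
Hypothesis lP : forall r, {in D_space aZ aN s, forall x, l r * x \in D_space aZ aN s}.
Hypothesis l1 : {in D_space aZ aN s, forall x, l 1 * x = x}.
Hypothesis prK : {in Dorb_space aZ aN s, cancel pr l}.

Local Notation Ss := (S_alg aZ aN s).
Local Notation Cs := (stab_alg aZ aN s).
Local Notation iso := (@stab_iso F gT S to alpha aZ aN s).

Let X : mult_bimodule (tw_basis_alg aZ aN) R Ss :=
  @MultBimodule F _ (tw_basis_alg aZ aN) R Ss (D_space aZ aN s) l
    (@subalg_val _ _ _ _) lM (@subalg_valM _ _ _ _) lP (@D_rP _ _ _ _ _ aZ aN s)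
    l1 (@D_r1 _ _ _ _ _ aZ aN s).
Let B : bimodule R Ss := bimodule_of X.

Let e : A := twb 1%g s.

Let mul_e x : x \in D_space aZ aN s -> x * e = x.
Proof. exact: D_r1. Qed.

Let eD : e \in D_space aZ aN s.
Proof. by apply: basis_in_span; rewrite inE /=. Qed.

Let SsD x : x \in S_space aZ aN s -> x \in D_space aZ aN s.
Proof.
move=> /mem_span_basis xS; apply/mem_span_basis => -[g t] /= ts; apply: xS.
by rewrite inE /= negb_and [_ != _]ts orbT.
Qed.

Let DDorb x : x \in D_space aZ aN s -> x \in Dorb_space aZ aN s.
Proof.
move=> /mem_span_basis xS; apply/mem_span_basis => -[g t] /= ts; apply: xS.
by apply: contra ts => /eqP /= ->; apply: orbit_refl.
Qed.

(** Left multiplication by [e] kills [twb h s] unless h fixes s. *)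
Let e_mulD : {in D_space aZ aN s, forall x, e * x \in S_space aZ aN s}.
Proof.
move=> x; apply: (@span_basis_mul _ _ _ (pred1 (1%g, s))).
  move=> [g t] [h u] /eqP[-> ->] /eqP /= ->.
  rewrite [_ * _]twb_mul; case: eqP => hs; last exact: mem0v.
  apply/memvZ/basis_in_span; rewrite inE /= eqxx andbT mul1g.
  exact/astab1P.
by apply: basis_in_span; rewrite inE.
Qed.

Let ee : e * e = e.
Proof. exact/mul_e/eD. Qed.

Let e0 : B := Subvs eD : mb_sort X.
(** The idempotents at the points of the orbit of [s]; the value 0 elsewhere allows all of [S] as
    index type. *)
Let u t : R := if t \in orbit to setT s then pr (twb 1%g t) else 0.
Let tau (x : B) : Ss := Subvs (e_mulD (subvsP (x : mb_sort X))).

Let e_pr : l (pr e) = e.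
Proof. exact/prK/DDorb/eD. Qed.

(** A point sg of the orbit is joined to s by an invertible morphism, so its idempotent is this
    morphism times [e] times the inverse. *)
Let u_two_sided t : exists c d, u t = c * pr e * d.
Proof.
rewrite /u; case: ifP => [/orbitP[g _ <-]|_]; last first.
  by exists 0, 0; rewrite mulr0.
have cD : twb g^-1%g s \in Dorb_space aZ aN s.
  by apply/DDorb/basis_in_span; rewrite inE /=.
have dD : twb_inv g^-1%g s \in Dorb_space aZ aN s.
  by apply/memvZ/basis_in_span; rewrite inE /= orbit_setT.
have tD : twb 1%g (to s g) \in Dorb_space aZ aN s.
  by apply: basis_in_span; rewrite inE /= orbit_setT.
exists (pr (twb g^-1%g s)), (pr (twb_inv g^-1%g s)); apply: l_inj.
rewrite !lM e_pr !prK // mul_e; last by apply: basis_in_span; rewrite inE /=.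
by rewrite twb_mulV invgK.
Qed.

Lemma orbit_idem_nonzero (V : lmodType R) (v : V) t :
  t \in orbit to setT s -> pr (twb 1%g t) *: v != 0 ->
  exists v' : V, pr e *: v' != 0.
Proof.
have [c [d E]] := u_two_sided t; move: E; rewrite /u => + ts; rewrite ts => ->.
move=> nz; exists (d *: v); apply: contraNneq nz => E.
by rewrite -!scalerA E scaler0.
Qed.

Lemma Ind_simple_frame (M : lmodType Cs) :
  simple_module M -> simple_module (tensor B (restr iso M)).
Proof.
move=> simM; have [iso' _ isoK] := @stab_iso_bij _ _ _ _ _ aZ aN s.
apply: (@ind_simple R Ss B (pr e) e0 S u tau) => //.
- move=> x; exists (pr (mb_val (x : mb_sort X))); apply: mb_val_inj.
  rewrite /mb_val /= prK; last exact/DDorb/subvsP.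
  by rewrite mul_e //; apply: subvsP.
- move=> x; exists (tau x); apply: mb_val_inj.
  by rewrite /mb_val /= e_pr mulrA ee.
(* The [u t] sum to the identity of D(O_s), which fixes D(s). *)
- move=> x; apply: mb_val_inj; rewrite [LHS](raddf_sum vsval) /=.
  rewrite -[RHS](@D_l1 _ _ _ _ _ aZ aN s) ?subvsP // subalg_val1 /= /Dorb_one.
  rewrite mulr_suml [RHS]big_mkcond; apply: eq_bigr => t _.
  rewrite /mb_val /= /u; case: ifP => ts; last by rewrite raddf0 mul0r.
  by rewrite prK //; apply: basis_in_span; rewrite inE.
- by move=> x y; apply: subalg_val_inj; rewrite /subalg_val /= mulrDr.
- by move=> x a; apply: subalg_val_inj; rewrite /subalg_val /= mulrA.
- exact: subalg_val_inj.
- by apply: restr_simple => // b; exists (iso' b); apply: isoK.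
Qed.

(** The module [M] is eV, on which the twisted group algebra acts through its identification with
    S(s), a corner of [R] with identity [pr e]. *)
Lemma simple_Ind_frame (V : lmodType R) :
  simple_module V -> (exists v : V, pr e *: v != 0) ->
  exists M : lmodType Cs,
    simple_module M /\ module_iso V (tensor B (restr iso M)).
Proof.
move=> simV nzV; have [iso' isoK iso'K] := @stab_iso_bij _ _ _ _ _ aZ aN s.
have SDorb (a : Ss) : subalg_val a \in Dorb_space aZ aN s.
  exact/DDorb/SsD/subvsP.
have fD : {morph (fun a : Cs => pr (subalg_val (iso' a))) : a b / a + b}.
  move=> a b; have -> : iso' (a + b) = iso' a + iso' b.
    by apply: (can_inj isoK); rewrite iso'K [RHS]raddfD /= !iso'K.
  by apply: l_inj; rewrite [RHS]raddfD !prK // raddfD.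
have fM : {morph (fun a : Cs => pr (subalg_val (iso' a))) : a b / a * b}.
  move=> a b; have -> : iso' (a * b) = iso' a * iso' b.
    by apply: (can_inj isoK); rewrite iso'K [RHS]rmorphM /= !iso'K.
  by apply: l_inj; rewrite lM !prK.
pose f := CornerMap fD fM.
have f1 : f 1 = pr e.
  by rewrite /= -(rmorph1 iso) isoK.
(* The preimage of e r e is the element e(re) of S(s), where re lies in D(s). *)
have f_corner r : exists a, f a = f 1 * r * f 1.
  have rD : l r * e \in D_space aZ aN s by apply/lP/eD.
  exists (iso (Subvs (e_mulD rD))); apply: l_inj.
  by rewrite f1 !lM !e_pr -mulrA [LHS](prK (SDorb _)) isoK.
have simM : simple_module (corner_module f V).
  by apply: corner_simple => //; rewrite f1.
exists (corner_module f V); split=> //.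
have jK (x : mb_sort X) : l (pr (mb_val x)) = mb_val x.
  exact/prK/DDorb/subvsP.
apply: (@corner_ind_iso R Ss Cs iso B f (fun x : B => pr (mb_val (x : mb_sort X))) e0).
- by move=> x y; apply: l_inj; rewrite [RHS]raddfD !jK.
- by move=> r x; apply: l_inj; rewrite lM !jK.
- by move=> x a; apply: l_inj; rewrite lM !jK /= isoK prK.
- by rewrite f1.
- exact: simV.
- by rewrite f1.
- exact: Ind_simple_frame.
Qed.

End Induction.

End TwistedAlgebraTheory.

(** * Classification of the simple modules *)

Section Conclusion.
Variables (F : fieldType) (gT : finGroupType) (S : finType).
Variables (to : {action gT &-> S}) (alpha : gT -> gT -> {ffun S -> F}).
Hypotheses (aZ : two_cocycle to alpha) (aN : normalized alpha).
Local Notation A := (twisted_alg aZ aN).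
Implicit Types s t : S.

Let prD s (x : A) : Dorb aZ aN s := vsproj (Dorb_space aZ aN s) x.

Let prDK s : {in Dorb_space aZ aN s, cancel (@prD s) (@subalg_val _ _ _ _)}.
Proof. exact: vsprojK. Qed.

Lemma Ind_orb_simple s (M : lmodType (stab_alg aZ aN s)) :
  simple_module M -> simple_module (Ind_orb M).
Proof.
exact: (@Ind_simple_frame _ _ _ _ _ aZ aN s (Dorb aZ aN s)
  (@subalg_val _ _ _ _) (@prD s) _ (@subalg_val_inj _ _ _ _) _ _ (@prDK s)).
Qed.

Lemma Ind_simple s (M : lmodType (stab_alg aZ aN s)) :
  simple_module M -> simple_module (Ind M).
Proof.
exact: (@Ind_simple_frame _ _ _ _ _ aZ aN s A idfun idfun).
Qed.

Lemma nonzero_component (R : pzRingType) (V : lmodType R) (I : finType)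
    (P : pred I) (u : I -> R) :
  simple_module V -> \sum_(i | P i) u i = 1 ->
  exists v : V, exists2 i, P i & u i *: v != 0.
Proof.
move=> [_ [v _ v0] _] u1; apply: boolp.contrapT => noi; case/eqP: v0.
rewrite -[v]scale1r -u1 scaler_suml big1 // => i Pi.
by apply: boolp.contrapT => /eqP ui; apply: noi; exists v, i.
Qed.

Lemma Ind_orb_exhaustive s (V : lmodType (Dorb aZ aN s)) :
  simple_module V -> exists M : lmodType (stab_alg aZ aN s),
    simple_module M /\ module_iso V (Ind_orb M).
Proof.
move=> simV.
have sum1 : \sum_(t in orbit to setT s) prD s (twb aZ aN 1%g t) = 1.
  apply: subalg_val_inj; rewrite subalg_val1 raddf_sum /=.
  apply: eq_bigr => t ts; rewrite prDK //.
  by apply: basis_in_span; rewrite inE.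
have [v [t ts nz]] := nonzero_component simV sum1.
apply: (@simple_Ind_frame _ _ _ _ _ aZ aN s (Dorb aZ aN s)
  (@subalg_val _ _ _ _) (@prD s) _ (@subalg_val_inj _ _ _ _) _ _ (@prDK s)) => //.
exact: (@orbit_idem_nonzero _ _ _ _ _ aZ aN s (Dorb aZ aN s)
  (@subalg_val _ _ _ _) (@prD s) (@subalg_valM _ _ _ _)
  (@subalg_val_inj _ _ _ _) (@prDK s) _ _ _ ts nz).
Qed.

(** Some idempotent at a point t does not kill [V]. The representative of the orbit of t supplied by
    [P] then has a nonzero corner, as idempotents in one orbit factor through each other. *)
Lemma Ind_exhaustive (V : lmodType A) (P : pred S) :
  (forall t, exists2 s, P s & t \in orbit to setT s) ->
  simple_module V -> exists2 s, P s & exists M : lmodType (stab_alg aZ aN s),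
    simple_module M /\ module_iso V (Ind M).
Proof.
move=> coverP simV.
have [v [t _ nz]] := nonzero_component simV (sum_twb1 aZ aN).
have [s Ps ts] := coverP t; exists s => //.
apply: (@simple_Ind_frame _ _ _ _ _ aZ aN s A idfun idfun) => //.
exact: (@orbit_idem_nonzero _ _ _ _ _ aZ aN s A idfun idfun _ _ _ _ _ _ ts nz).
Qed.

End Conclusion.

Theorem theorem3p6 (R : realType) (G : finGroupType) (S : finType)
    (to : {action G &-> S}) (alpha : G -> G -> {ffun S -> R[i]})
    (alphaZ : two_cocycle to alpha) (alphaN : normalized alpha) :
  (forall s : S,
     [/\ semisimple_ring (Dorb alphaZ alphaN s),
         forall M : lmodType (stab_alg alphaZ alphaN s),
           simple_module M -> simple_module (Ind_orb M)
       & forall V : lmodType (Dorb alphaZ alphaN s),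
           simple_module V ->
           exists M : lmodType (stab_alg alphaZ alphaN s),
             simple_module M /\ module_iso V (Ind_orb M)])
  /\
  (forall (J : finType) (O : J -> {set S}) (rep : J -> S),
     (forall j, O j \in orbit to [set: G] @: [set: S]) ->
     (forall j j', j != j' -> [disjoint O j & O j']) ->
     \bigcup_(j : J) O j = [set: S] ->
     (forall j, rep j \in O j) ->
     [/\ semisimple_ring (twisted_alg alphaZ alphaN),
         forall (j : J) (M : lmodType (stab_alg alphaZ alphaN (rep j))),
           simple_module M -> simple_module (Ind M)
       & forall V : lmodType (twisted_alg alphaZ alphaN),
           simple_module V ->
           exists (j : J) (M : lmodType (stab_alg alphaZ alphaN (rep j))),
             simple_module M /\ module_iso V (Ind M)]).
Proof.
(* The scalars have characteristic zero, so the order of [G] is invertible. *)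
have charR : #|G|%:R != 0 :> R[i].
  by rewrite pnatr_eq0 -lt0n; apply/card_gt0P; exists 1%g.
split=> [s|J O rep orbO _ coverO repO].
  split; [exact: Dorb_semisimple | exact: Ind_orb_simple | ].
  exact: Ind_orb_exhaustive.
split=> [|j M|V simV]; [exact: twisted_alg_semisimple | exact: Ind_simple | ].
have [t|_ /codomP[j ->] M] := @Ind_exhaustive _ _ _ _ _ alphaZ alphaN V
  [pred s in codom rep] _ simV; last by exists j.
(* Each t lies in some [O j], which is an orbit containing [rep j], hence the orbit of [rep j]. *)
have : t \in \bigcup_(j : J) O j by rewrite coverO inE.
case/bigcupP=> j _ tj; exists (rep j); first exact: codom_f.
have /imsetP[s _ Oj] := orbO j; move: tj (repO j); rewrite Oj.
by move=> ts /orbit_in_eqP->.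
Qed.
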